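(* Let $G$ be a $K_4$-minor-free graph with girth at least $4$ (i.e. $G$ is triangle-free). Then $\chi_c^{\star}(G)\leq 4$ and $\chi_{\ell}^{\bullet}(G)\le 3$, $\chi_{\ell}^{\star}(G)\le 3$, $\chi_c^{\bullet}(G)\leq 3$. All of these inequalities are sharp, with equality attained by cycles.
   Context: All graphs are finite and simple. A correspondence-cover of a graph $G$ is a pair $(L,H)$ where $H$ is a graph and $L$ maps each $v\in V(G)$ to a subset $L(v)\subseteq V(H)$ such that: the sets $L(v)$ partition $V(H)$; each $L(v)$ induces a clique in $H$; if $uv\notin E(G)$ there are no edges of $H$ between $L(u)$ and $L(v)$; if $uv\in E(G)$ the edges of $H$ between $L(u)$ and $L(v)$ form a matching. It is $k$-fold if all $|L(v)|=k$. A list-cover is the cover arising from a list-assignment $v\mapsto L(v)\subseteq\mathbb{N}$: vertices $(v,x)$, $x\in L(v)$, cliques on lists, edges $(u,x)(v,x)$ for $uv\in E(G)$. An independent transversal is an independent set of $H$ with exactly one vertex in each $L(v)$. A $k$-fold cover has a packing if it has $k$ pairwise disjoint independent transversals, and a fractional packing if there is a probability distribution on independent transversals $I$ with $\Pr(x\in I)=1/|L(v)|$ for all $v$, $x\in L(v)$. $\chi_c^\star(G)$ (resp. $\chi_c^\bullet(G)$) is the least $k$ such that every $k$-fold correspondence-cover has a packing (resp. fractional packing); $\chi_\ell^\star(G)$, $\chi_\ell^\bullet(G)$ are defined the same way using only $k$-fold list-covers. *)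

(* Defs.v *)
From HB Require Import structures.
From mathcomp Require Import all_boot all_order all_algebra.
From mathcomp Require Import reals.
Set Implicit Arguments. Unset Strict Implicit. Unset Printing Implicit Defensive.
Import Order.TTheory GRing.Theory Num.Theory.
Local Open Scope ring_scope.

Section Defs.
Variable T : finType.
Variable g : rel T.

Definition simple_graph := symmetric g /\ irreflexive g.

Definition triangle_free :=
  forall x y z : T, ~ [/\ g x y, g y z & g x z].

Definition induced_connected (B : {set T}) :=
  forall x y, x \in B -> y \in B ->
    connect (fun a b => [&& a \in B, b \in B & g a b]) x y.

Definition has_K4_minor :=
  exists B : 'I_4 -> {set T},
    [/\ forall i, B i != set0,
        forall i, induced_connected (B i),
        forall i j, i != j -> [disjoint B i & B j] &
        forall i j, i != j -> exists x y, [/\ x \in B i, y \in B j & g x y]].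

Definition is_cover (V : finType) (h : rel V) (L : T -> {set V}) :=
  [/\ symmetric h /\ irreflexive h,
      ((forall x : V, exists v, x \in L v) /\
       (forall u v x, x \in L u -> x \in L v -> u = v)),
      (forall v x y, x \in L v -> y \in L v -> x != y -> h x y),
      (forall u v x y, u != v -> ~~ g u v -> x \in L u -> y \in L v -> ~~ h x y) &
      (forall u v x y y', g u v -> x \in L u -> y \in L v -> y' \in L v ->
          h x y -> h x y' -> y = y')].

Definition is_kfold_cover (V : finType) (h : rel V) (L : T -> {set V}) (k : nat) :=
  is_cover h L /\ forall v, #|L v| = k.

(* (L,H) is (isomorphic to) the list-cover of some list assignment:
   the label lab x is the colour of x, distinct within each list, and
   between distinct L u, L v, the edges are exactly the pairs with
   uv in E(G) and equal colours. *)
Definition is_list_cover (V : finType) (h : rel V) (L : T -> {set V}) :=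
  is_cover h L /\
  exists lab : V -> nat,
    (forall v, {in L v &, injective lab}) /\
    (forall u v x y, u != v -> x \in L u -> y \in L v ->
        h x y = g u v && (lab x == lab y)).

Definition indep_transversal (V : finType) (h : rel V) (L : T -> {set V})
  (I : {set V}) :=
  (forall x y, x \in I -> y \in I -> ~~ h x y) /\
  (forall v, #|I :&: L v| = 1%N).

Definition has_packing (V : finType) (h : rel V) (L : T -> {set V}) (k : nat) :=
  exists Is : 'I_k -> {set V},
    (forall i, indep_transversal h L (Is i)) /\
    (forall i j, i != j -> [disjoint Is i & Is j]).

Definition has_frac_packing (R : realType) (V : finType) (h : rel V)
  (L : T -> {set V}) :=
  exists w : {set V} -> R,
    [/\ forall I, 0 <= w I,
        forall I, w I != 0 -> indep_transversal h L I,
        \sum_(I : {set V}) w I = 1 &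
        forall v x, x \in L v -> \sum_(I : {set V} | x \in I) w I = (#|L v|%:R)^-1].

Definition P_c_star (k : nat) :=
  forall (V : finType) (h : rel V) (L : T -> {set V}),
    is_kfold_cover h L k -> has_packing h L k.
Definition P_l_star (k : nat) :=
  forall (V : finType) (h : rel V) (L : T -> {set V}),
    is_kfold_cover h L k -> is_list_cover h L -> has_packing h L k.
Definition P_c_frac (R : realType) (k : nat) :=
  forall (V : finType) (h : rel V) (L : T -> {set V}),
    is_kfold_cover h L k -> has_frac_packing R h L.
Definition P_l_frac (R : realType) (k : nat) :=
  forall (V : finType) (h : rel V) (L : T -> {set V}),
    is_kfold_cover h L k -> is_list_cover h L -> has_frac_packing R h L.

End Defs.

(* "chi <= m" where chi is the least positive k with property P *)
Definition chi_le (P : nat -> Prop) (m : nat) := exists k, (0 < k <= m)%N /\ P k.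
Definition chi_eq (P : nat -> Prop) (m : nat) := chi_le P m /\ ~ chi_le P m.-1.

(* the cycle C_n on vertex set 'I_n (a cycle for n >= 3) *)
Definition cycle_rel (n : nat) : rel 'I_n :=
  fun i j => (nat_of_ord j == (i.+1 %% n)%N) || (nat_of_ord i == (j.+1 %% n)%N).
Arguments cycle_rel n : clear implicits.

(* Main.v *)
Require Import Defs.
From mathcomp Require Import all_boot all_order all_algebra reals.
From mathcomp Require Import zify.
Set Implicit Arguments. Unset Strict Implicit. Unset Printing Implicit Defensive.

(** A K4-minor-free graph has a vertex [x] of degree at most 2; if its neighbours are
    [a] and [b], contracting [xa] deletes [x] and creates a virtual edge [ab]. So the
    graph can be rebuilt by adding vertices with at most two earlier neighbours [a], [b],
    provided that we have imposed in advance a suitable relation across [ab]. Because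
    there is no triangle, [x] is never joined by true edges to the ends of a true edge, and
    the following relations across the virtual edges are preserved:
    - 4-fold correspondence packings: no relation at all, since any two partial
      injections of a 4-set are avoided by a common permutation;
    - 3-fold list packings: no two common colours of [L a] and [L b] are exchanged;
    - 3-fold fractional correspondence packings: the colours of [a] and [b] are
      independent and uniform, while across a true edge they are uniform on the pairs
      outside a perfect matching.
    On cycles the lower bounds are parity obstructions around the cycle. *)

(** * Minors and contractions *)

(** With three colours the obstacle is parity. If the orderings at [a] and [b], read in the list of
    [x], differ by a transposition, then each of the two permutations avoiding one of them meets the
    other, and [x] cannot be joined to both. Forbidding exchanged colours across [ab] removes this
    obstruction. But a relation imposed in advance must itself be attainable whenever a later vertex
    is added, so every combination of true and virtual edges among [x], [a], [b] has to be checked,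
    except three true edges. Read in the list of [x], these checks concern three or four colours
    only and are settled by computation. List colours identify [L a] with [L b] even across a
    nonedge. In a correspondence-cover the matchings at [x] can identify them in any way, so there
    the relation across [ab] is chosen insensitive to relabelling: nothing at all for orderings,
    independence for distributions. *)

Section Minors.
Variable T : finType.
Implicit Types (g e : rel T) (x y z u v w s t : T) (A B S : {set T}).

Lemma induced_connected_mono g e B :
  subrel e g -> induced_connected e B -> induced_connected g B.
Proof.
move=> eg cB x y xB yB; apply: connect_sub (cB x y xB yB) => a b.
by case/and3P=> aB bB /eg gab; apply: connect1; rewrite aB bB gab.
Qed.

Lemma K4_minor_mono g e : subrel e g -> has_K4_minor e -> has_K4_minor g.
Proof.
move=> eg [B [B0 Bc Bd Ba]]; exists B; split=> // [i|i j /Ba [x [y [xi yj exy]]]].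
  exact: induced_connected_mono (Bc i).
by exists x, y; split=> //; apply: eg.
Qed.

Lemma induced_connected_isolated e B x y :
  induced_connected e B -> x \in B -> y \in B -> (forall z, ~~ e x z) -> y = x.
Proof.
move=> cB xB yB ex; case/connectP: (cB x y xB yB) => [[|z p]] //= /andP[].
by rewrite (negbTE (ex z)) !andbF.
Qed.

(** [u] is merged into [v] on the same vertex type: it stays as an isolated vertex, and [x != y]
    drops the loop that the edge [uv] would leave at [v]. *)
Definition contract g u v : rel T := fun x y =>
  [&& x != u, y != u, x != y & [|| g x y, (x == v) && g u y | (y == v) && g u x]].

Lemma contract_sym g u v : symmetric g -> symmetric (contract g u v).
Proof.
move=> gs x y; rewrite /contract (eq_sym x y) (gs x y).
by rewrite andbCA [_ && g u y || _]orbC.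
Qed.

Lemma contract_irr g u v : irreflexive (contract g u v).
Proof. by move=> x; rewrite /contract eqxx !andbF. Qed.

(** A minor of the contraction lifts by adding [u] to the branch set that contains [v]: an edge
    inherited from [u] is rerouted through [u]. *)
Lemma K4_minor_contract g u v :
  symmetric g -> irreflexive g -> g u v ->
  has_K4_minor (contract g u v) -> has_K4_minor g.
Proof.
move=> gs gi guv [B [B0 Bc Bd Ba]].
have uv : u != v by apply/eqP=> E; rewrite E gi in guv.
(* Being isolated after the contraction, [u] could only form a singleton branch set, without edges
   to the others. *)
have uB i : u \notin B i.
  apply/negP=> ui.
  have [j ij] : exists j : 'I_4, i != j.
    by case: (eqVneq i ord0) => [->|ne]; [exists (lift ord0 ord0) | exists ord0].
  case: (Ba i j ij) => x [y [xi _ exy]].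
  have E : x = u.
    by apply: (induced_connected_isolated (Bc i) ui xi) => z; rewrite /contract eqxx.
  by move: exy; rewrite E /contract eqxx.
pose B' i := if v \in B i then u |: B i else B i.
have sB i : B i \subset B' i by rewrite /B'; case: ifP => // _; apply: subsetUr.
have uB' i : v \in B i -> u \in B' i by rewrite /B' => ->; apply: setU11.
have step i x y : x \in B i -> y \in B i -> contract g u v x y ->
    connect (fun a b => [&& a \in B' i, b \in B' i & g a b]) x y.
  move=> xi yi; have xi' := subsetP (sB i) _ xi; have yi' := subsetP (sB i) _ yi.
  case/and4P=> _ _ _ /or3P[gxy|/andP[/eqP E guy]|/andP[/eqP E gux]].
  - by apply: connect1; rewrite xi' yi'.
  - subst x; have ui := uB' i xi.
    apply: (@connect_trans _ _ u); apply: connect1; first by rewrite xi' ui gs guv.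
    by rewrite yi' ui guy.
  - subst y; have ui := uB' i yi.
    apply: (@connect_trans _ _ u); apply: connect1; last by rewrite yi' ui guv.
    by rewrite xi' ui gs gux.
have stepc i x y : x \in B i -> y \in B i ->
    connect (fun a b => [&& a \in B' i, b \in B' i & g a b]) x y.
  move=> xi yi; apply: connect_sub (Bc i x y xi yi) => a b /and3P[ai bi].
  exact: step.
exists B'; split=> [i|i x y|i j ij|i j ij].
- by case/set0Pn: (B0 i) => x /(subsetP (sB i)) xi; apply/set0Pn; exists x.
- case: (boolP (v \in B i)) => vi; last first.
    by move=> xi yi; apply: stepc; move: xi yi; rewrite /B' (negbTE vi).
  have ui := uB' i vi; have vi' := subsetP (sB i) _ vi.
  have uc z : z \in B' i ->
      connect (fun a b => [&& a \in B' i, b \in B' i & g a b]) v z.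
    rewrite {1}/B' vi => /setU1P[->|zi]; last exact: stepc.
    by apply: connect1; rewrite ui vi' gs guv.
  move=> xi yi; apply: (@connect_trans _ _ v); last exact: uc.
  rewrite sym_connect_sym; first exact: uc.
  by move=> a b; rewrite gs andbCA.
- rewrite -setI_eq0; apply/eqP/setP=> z; rewrite in_set0 in_setI /B'; apply/negP.
  have D k l : k != l -> z \in B k -> z \in B l -> False.
    move=> kl zk zl; have := Bd k l kl; rewrite -setI_eq0 => /eqP/setP/(_ z).
    by rewrite in_setI zk zl in_set0.
  have Dv : v \in B i -> v \in B j -> False.
    move=> zk zl; have := Bd i j ij; rewrite -setI_eq0 => /eqP/setP/(_ v).
    by rewrite in_setI zk zl in_set0.
  case: ifP => vi; case: ifP => vj; rewrite ?inE; case/andP.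
  + by case: (Dv vi vj).
  + by case/orP=> [/eqP->|zi zj]; [apply/negP | apply: (D i j)].
  + by move=> zi /orP[/eqP zu|zj]; [move: (uB i); rewrite -zu zi | apply: (D i j)].
  + by move=> zi zj; apply: (D i j).
- case: (Ba i j ij) => x [y [xi yj]].
  have xi' := subsetP (sB i) _ xi; have yj' := subsetP (sB j) _ yj.
  case/and4P=> _ _ _ /or3P[gxy|/andP[/eqP E guy]|/andP[/eqP E gux]].
  + by exists x, y.
  + by exists u, y; split=> //; apply: uB'; rewrite -E.
  + by exists x, u; split=> //; [apply: uB'; rewrite -E | rewrite gs].
Qed.

Definition nbrs g x := [set y | g x y].

Lemma path_set_connected g x p :
  symmetric g -> path g x p -> induced_connected g [set z in x :: p].
Proof.
move=> gs gp; set B := [set z in x :: p].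
have sB : {subset x :: p <= B} by move=> a; rewrite in_set.
have from_x z : z \in x :: p -> connect (fun a b => [&& a \in B, b \in B & g a b]) x z.
  move: gp sB; move: B => B; elim: p x => [|y p IH] x /= gp sB; first by rewrite inE => /eqP->.
  case/andP: gp => gxy gp; rewrite inE => /orP[/eqP->|zp]; first exact: connect0.
  apply: (@connect_trans _ _ y).
    by apply: connect1; rewrite gxy !sB ?inE ?eqxx ?orbT.
  by apply: IH => // a ap; apply: sB; rewrite inE ap orbT.
move=> a b; rewrite !in_set => aB bB.
apply: (@connect_trans _ _ x); last exact: from_x.
by rewrite sym_connect_sym ?from_x // => c d; rewrite gs andbCA.
Qed.

Lemma maximal_path e x :
  symmetric e -> exists y p, [/\ uniq (y :: p), path e y p, x \in y :: p &
                               forall z, e y z -> z \in y :: p].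
Proof.
move=> es.
suff H n y p : #|T| - size p <= n -> uniq (y :: p) -> path e y p -> x \in y :: p ->
    exists y p, [/\ uniq (y :: p), path e y p, x \in y :: p &
                   forall z, e y z -> z \in y :: p].
  by apply: (H _ x [::]) => //; rewrite inE.
elim: n y p => [|n IH] y p le_n up ep xp; last first.
  case: (boolP [forall z, e y z ==> (z \in y :: p)]) => [/forallP H|].
    by exists y, p; split=> // z; apply/implyP.
  case/forallPn=> z; rewrite negb_imply => /andP[eyz zp].
  apply: (IH z (y :: p)); first by move: le_n => /=; lia.
  - by rewrite cons_uniq zp up.
  - by rewrite /= es eyz.
  - by rewrite inE xp orbT.
have : size (y :: p) <= #|T| by rewrite -(card_uniqP up) max_card.
by move: le_n => /=; lia.
Qed.

(** The neighbourhood of [v] induces a graph of minimum degree at least two. A maximal path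
    [y, a, b, ...] in it contains all neighbours of [y] there, so one of them, [c], comes after [a].
    The branch sets are [{v}], [{y}], [{a}] and the tail starting at [b]. *)
Lemma K4_minor_wheel g v x :
  symmetric g -> irreflexive g -> g v x ->
  (forall y, g v y -> 1 < #|[set z | g v z && g y z]|) -> has_K4_minor g.
Proof.
move=> gs gi gvx deg2.
pose e : rel T := fun y z => [&& g v y, g v z & g y z].
have es : symmetric e by move=> y z; rewrite /e (gs y z) andbCA.
have [y [p [up ep xp ymax]]] := maximal_path x es.
have pN z : z \in y :: p -> g v z.
  have allN a q : path e a q -> g v a -> all (g v) (a :: q).
    elim: q a => [|b q IH] a /=; first by move=> _ ->.
    by case/andP=> /and3P[-> gb _] eq _; apply: IH.
  have {allN}allN2 a q : path e a q -> x \in a :: q -> all (g v) (a :: q).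
    case: q => [|b q] /=; first by rewrite inE => _ /eqP <-; rewrite gvx.
    by case/andP=> /and3P[ga gb _] eq _; rewrite ga /=; apply: allN.
  by move=> zp; apply: (allP (allN2 _ _ ep xp)).
have gvy : g v y by apply: pN; rewrite inE eqxx.
have ey z : g v z && g y z -> z \in p.
  case/andP=> gz gyz; have := ymax z; rewrite /e gvy gz gyz inE => /(_ isT).
  by case/orP=> // /eqP E; move: gyz; rewrite E gi.
case: p up ep xp ymax pN ey => [|a [|b q]] up ep xp ymax pN ey.
- have := deg2 y gvy; rewrite (_ : [set z | _] = set0) ?cards0 //.
  by apply/setP=> z; rewrite !inE; apply/negP=> /ey.
- have := deg2 y gvy; rewrite ltnNge => /negP[]; rewrite -(cards1 a) subset_leq_card //.
  by apply/subsetP=> z; rewrite !inE => /ey; rewrite inE.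
have [c cq gyc] : exists2 c, c \in b :: q & g y c.
  have /card_gt0P[c] : 0 < #|[set z | g v z && g y z] :\ a|.
    by move: (deg2 y gvy); rewrite (cardsD1 a); case: (_ \in _) => //=; lia.
  rewrite !inE => /andP[ca /[dup] /ey]; rewrite inE (negbTE ca) /= => cq /andP[_ gyc].
  by exists c.
have vP z : z \in y :: a :: b :: q -> v != z.
  by move=> /pN gz; apply/eqP=> E; rewrite E gi in gz.
have [ya yq aq] : [/\ y != a, y \notin b :: q & a \notin b :: q].
  by move: up; rewrite /= !inE !negb_or => /and3P[/and3P[-> -> ->] /andP[-> ->]].
case/andP: ep => /and3P[_ ga gya] /= /andP[/and3P[_ gb gab]] eq.
have pq : path g b q.
  by apply: sub_path eq => c' d /and3P[].
pose B (i : 'I_4) := nth set0 [:: [set v]; [set y]; [set a]; [set z in b :: q]] i.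
have c1 z : induced_connected g [set z].
  by move=> c' d; rewrite !inE => /eqP-> /eqP->; apply: connect0.
have sym (P : 'I_4 -> 'I_4 -> Prop) : (forall i j, P i j -> P j i) ->
    (forall i j : 'I_4, i < j -> P i j) -> forall i j, i != j -> P i j.
  move=> Ps Plt i j; rewrite -val_eqE neq_ltn => /orP[/Plt//|/Plt/Ps//].
exists B; split.
- case; case=> [|[|[|[|]]]] //= lt; apply/set0Pn; rewrite /B /=.
  + by exists v; rewrite inE.
  + by exists y; rewrite inE.
  + by exists a; rewrite inE.
  + by exists b; rewrite !inE eqxx.
- case; case=> [|[|[|[|]]]] //= lt; rewrite /B /=; try exact: c1.
  exact: path_set_connected.
- apply: sym => [i j|]; first by rewrite disjoint_sym.
  case; case=> [|[|[|[|]]]] //= ilt; case; case=> [|[|[|[|]]]] //= jlt _;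
    rewrite /B /= disjoints1 ?inE //.
  + by rewrite (vP y) // inE eqxx.
  + by rewrite (vP a) // !inE eqxx orbT.
  + apply/negP=> vq; have := vP v; rewrite eqxx !inE.
    by rewrite vq !orbT => /(_ isT).
- apply: sym => [i j [c' [d [ci dj gcd]]]|]; first by exists d, c'; rewrite gs.
  case; case=> [|[|[|[|]]]] //= ilt; case; case=> [|[|[|[|]]]] //= jlt _;
    rewrite /B /=.
  + by exists v, y; rewrite !inE !eqxx gvy.
  + by exists v, a; rewrite !inE !eqxx ga.
  + by exists v, b; rewrite !inE !eqxx gb.
  + by exists y, a; rewrite !inE !eqxx gya.
  + by exists y, c; rewrite !inE !eqxx gyc; split=> //; rewrite -in_cons.
  + by exists a, b; rewrite !inE !eqxx gab.
Qed.

End Minors.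

(** * Minimum degree three forces a K4 minor *)

Section Degrees.
Variable T : finType.
Implicit Types (g e : rel T) (x y z u v w s t : T) (A B S : {set T}).

Lemma card_gt2_avoid A a b : 2 < #|A| -> exists2 w, w \in A & (w != a) && (w != b).
Proof.
move=> A2; have /subsetPn[w wA] : ~~ (A \subset [set a; b]).
  by apply/negP=> /subset_leq_card; rewrite cards2; move: A2; case: (a != b) => /=; lia.
by rewrite !inE negb_or; exists w.
Qed.

(** Only common neighbours of [u] and [v] lose a neighbour; any other neighbour of [u] exchanges [u]
    for [v]. *)
Lemma contract_deg g u v w : irreflexive g -> w != u -> w != v ->
  ~~ (g w u && g w v) -> symmetric g -> #|nbrs g w| <= #|nbrs (contract g u v) w|.
Proof.
move=> gi wu wv nuv gs; case: (boolP (g w u)) => gwu.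
  have gwv : ~~ g w v by rewrite gwu in nuv.
  have uv : v != u by apply: contraNneq gwv => ->.
  have -> : #|nbrs g w| = #|v |: (nbrs g w :\ u)|.
    by rewrite cardsU1 (cardsD1 u) !inE gwu uv (negbTE gwv).
  apply: subset_leq_card; apply/subsetP=> z; rewrite !inE /contract wu.
  case/orP=> [/eqP->|/andP[zu gwz]]; first by rewrite uv wv eqxx (gs u w) gwu !orbT.
  by rewrite zu gwz andbT /=; apply: contraTneq gwz => <-; rewrite gi.
apply: subset_leq_card; apply/subsetP=> z; rewrite !inE /contract wu => gwz.
rewrite gwz /= andbT; apply/andP; split; first by apply: contraNneq gwu => <-.
by apply: contraTneq gwz => <-; rewrite gi.
Qed.

(** Dirac's theorem, strengthened for induction: the degree bound may fail at [s] and [t], equal or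
    adjacent. Apart from the merged vertex, a contraction lowers only the degrees of common
    neighbours of the contracted edge. The edge is chosen with at most one common neighbour, which
    together with the merged vertex forms the next exceptional pair. *)
Lemma K4_minor_of_degree n S g s t : #|S| <= n ->
  symmetric g -> irreflexive g -> (forall x y, g x y -> x \in S) ->
  s \in S -> t \in S -> (s == t) || g s t ->
  (exists2 w, w \in S & (w != s) && (w != t)) ->
  (forall w, w \in S -> w != s -> w != t -> 2 < #|nbrs g w|) -> has_K4_minor g.
Proof.
elim: n S g s t => [|n IH] S g s t cS gs gi gS sS tS st [w0 w0S w0st] deg3.
  by move: cS; rewrite leqn0 cards_eq0 => /eqP S0; rewrite S0 inE in sS.
have gS' x y : g x y -> y \in S by rewrite gs; apply: gS.
have cD x : x \in S -> #|S :\ x| <= n by move=> xS; move: cS; rewrite (cardsD1 x) xS.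
have supp u v x y : g u v -> contract g u v x y -> x \in S :\ u.
  move=> guv /and4P[xu _ _]; rewrite !inE xu.
  by case/or3P=> [/gS|/andP[/eqP-> _]|/andP[_ /gS']] //; apply: gS' guv.
case: (boolP [forall w in S, 2 < #|nbrs g w|]) => [/forall_inP all3|].
  (* Either an edge in at most one triangle can be contracted, or every edge lies in two triangles
     and the wheel argument applies. *)
  case: (boolP [exists u, [exists v, g u v && (#|[set z | g u z && g v z]| <= 1)]]).
    case/existsP=> u /existsP[v /andP[guv c1]].
    have uS := gS _ _ guv; have vS := gS' _ _ guv.
    have uv : v != u by apply: contraTneq guv => ->; rewrite gi.
    have [c [cS' cedge com]] : exists c, [/\ c \in S :\ u, (v == c) || contract g u v v c &
        forall w, g w u -> g w v -> w = c].
      case: (set_0Vmem [set z | g u z && g v z]) => [E|[c]].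
        exists v; split; rewrite ?eqxx ?inE ?uv // => w gwu gwv.
        have : w \in [set z | g u z && g v z] by rewrite inE gs gwu gs gwv.
        by rewrite E inE.
      rewrite inE => /andP[guc gvc]; have cu : c != u.
        by apply: contraTneq guc => ->; rewrite gi.
      have vc : v != c by apply: contraTneq gvc => ->; rewrite gi.
      exists c; split; rewrite ?inE ?cu ?(gS' _ _ guc) //.
        by rewrite /contract uv cu vc gvc orbT.
      move=> w gwu gwv; apply/eqP; move: c1; rewrite (cardsD1 c) inE guc gvc /= addSn add0n ltnS.
      rewrite leqn0 cards_eq0 => /eqP/setP/(_ w); rewrite !inE gs gwu gs gwv !andbT.
      by move/negbFE.
    apply: (K4_minor_contract gs gi guv).
    apply: (IH (S :\ u) (contract g u v) v c) => //.
    - exact: cD.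
    - exact: contract_sym.
    - exact: contract_irr.
    - by move=> x y; apply: supp.
    - by rewrite !inE uv.
    - have [w] := card_gt2_avoid u c (all3 v vS); rewrite inE => gvw /andP[wu wc].
      exists w; rewrite ?inE ?wu ?(gS' _ _ gvw) // wc andbT.
      by apply: contraTneq gvw => ->; rewrite gi.
    - move=> w; rewrite inE => /andP[]; rewrite inE => wu wS wv wc.
      apply: leq_trans (all3 w wS) (contract_deg gi wu wv _ gs).
      by apply/negP=> /andP[gwu gwv]; rewrite (com w gwu gwv) eqxx in wc.
  move/existsPn=> H; have [x] := card_gt2_avoid s s (all3 s sS).
  rewrite inE => gsx _; apply: (K4_minor_wheel gs gi gsx) => y gsy.
  by move/existsPn: (H s) => /(_ y); rewrite gsy /= -ltnNge.
case/forall_inPn=> s0 s0S; rewrite -leqNgt => s0deg.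
(* A vertex of degree at most two is exceptional, and by symmetry it may be called [s]. *)
have {sS tS st w0 w0S w0st deg3 s t s0S} [s [t [sS tS st third [deg3 sdeg]]]] :
    exists s t, [/\ s \in S, t \in S, (s == t) || g s t,
      (exists2 w, w \in S & (w != s) && (w != t)) &
      (forall w, w \in S -> w != s -> w != t -> 2 < #|nbrs g w|) /\ #|nbrs g s| <= 2].
  case: (eqVneq s0 s) => [E|s0s].
    by exists s, t; split=> //; [exists w0 | split=> //; rewrite -E].
  case: (eqVneq s0 t) => [E|s0t].
    exists t, s; split=> //; first by rewrite eq_sym gs.
      by exists w0; rewrite // andbC.
    by split; [move=> w wS wt ws; apply: deg3 | rewrite -E].
  by move: (deg3 s0 s0S s0s s0t); rewrite ltnNge s0deg.
(* An isolated [s] is deleted, and any other vertex then serves as both exceptions. *)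
case: (set_0Vmem (nbrs g s)) => [N0|[p0 p0N]].
  have iso x : g s x = false by have /setP/(_ x) := N0; rewrite !inE.
  have E : t = s by move: st; rewrite iso orbF => /eqP->.
  subst t; case: third => v vS /andP[vs _].
  apply: (IH (S :\ s) g v v) => //; rewrite ?eqxx ?inE ?vs ?cD //.
  - move=> x y gxy; rewrite !inE (gS _ _ gxy) andbT.
    by apply: contraTneq gxy => ->; rewrite iso.
  - have [w] := card_gt2_avoid v s (deg3 v vS vs vs); rewrite inE => gvw /andP[wv ws].
    by exists w; rewrite ?inE ?ws ?(gS' _ _ gvw) ?wv.
  - by move=> w; rewrite !inE => /andP[ws wS] _ _; apply: deg3.
have {tS st third deg3 p0 p0N t} [p [gsp [w0 w0S w0sp] deg3]] :
    exists p, [/\ g s p, (exists2 w, w \in S & (w != s) && (w != p)) &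
      (forall w, w \in S -> w != s -> w != p -> 2 < #|nbrs g w|)].
  case: (eqVneq s t) st => [E _|_ /= gst]; last by exists t.
  subst t; rewrite inE in p0N.
  have p0s : p0 != s by apply: contraTneq p0N => ->; rewrite gi.
  exists p0; split=> //; last by move=> w wS ws _; apply: deg3.
  have [w] := card_gt2_avoid p0 s (deg3 p0 (gS' _ _ p0N) p0s p0s).
  by rewrite inE => gw /andP[wp ws]; exists w; rewrite ?(gS' _ _ gw) ?ws.
have ps : p != s by apply: contraTneq gsp => ->; rewrite gi.
(* [q] is the second neighbour of [s], or [p] again if there is none; contracting [sp] leaves it
   equal or adjacent to [p]. *)
have [q [qS qedge com third]] : exists q, [/\ q \in S :\ s,
    (p == q) || contract g s p p q, forall w, g w s -> w != p -> w = q &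
    exists2 w, w \in S :\ s & (w != p) && (w != q)].
  case: (set_0Vmem (nbrs g s :\ p)) => [N0|[q]].
    exists p; split; rewrite ?eqxx ?inE ?ps ?(gS' _ _ gsp) //.
      by move=> w gws wp; have /setP/(_ w) := N0; rewrite !inE wp gs gws.
    by exists w0; case/andP: w0sp => ws wp; rewrite ?inE ?ws ?wp.
  rewrite !inE => /andP[qp gsq].
  have qs : q != s by apply: contraTneq gsq => ->; rewrite gi.
  exists q; split; rewrite ?inE ?qs ?(gS' _ _ gsq) //.
  - by rewrite /contract ps qs eq_sym qp eqxx gsq !orbT.
  - move=> w gws wp; apply/eqP.
    move: sdeg; rewrite (cardsD1 p) (cardsD1 q) !inE gsp qp gsq /= !addSn !add0n !ltnS.
    rewrite leqn0 cards_eq0 => /eqP/setP/(_ w); rewrite !inE gs gws wp !andbT.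
    by move/negbFE.
  - have [w] := card_gt2_avoid s p (deg3 q (gS' _ _ gsq) qs qp).
    rewrite inE => gqw /andP[ws wp]; exists w; rewrite ?inE ?ws ?(gS' _ _ gqw) ?wp //=.
    by apply: contraTneq gqw => ->; rewrite gi.
apply: (K4_minor_contract gs gi gsp); apply: (IH (S :\ s) (contract g s p) p q) => //.
- exact: cD.
- exact: contract_sym.
- exact: contract_irr.
- by move=> x y; apply: supp.
- by rewrite !inE ps (gS' _ _ gsp).
- move=> w; rewrite inE => /andP[]; rewrite inE => ws wS wp wq.
  apply: leq_trans (deg3 w wS ws wp) (contract_deg gi ws wp _ gs).
  by apply: contraNN wq => /andP[/com -> //].
Qed.

Lemma K4_minor_min_degree S g x :
  symmetric g -> irreflexive g -> (forall x y, g x y -> x \in S) -> x \in S ->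
  (forall w, w \in S -> 2 < #|nbrs g w|) -> has_K4_minor g.
Proof.
move=> gs gi gS xS deg; apply: (K4_minor_of_degree (leqnn #|S|) gs gi gS xS xS).
- by rewrite eqxx.
- have [w] := card_gt2_avoid x x (deg x xS); rewrite inE gs => /gS wS wx.
  by exists w.
- by move=> w wS _ _; apply: deg.
Qed.

End Degrees.

(** * Elimination by degree-two vertices *)

Section Elimination.
Variable T : finType.
Implicit Types (g e q : rel T) (x y z u v w s t a b : T) (S : {set T}).

(* [q] is the set of virtual edges. *)
Definition adj g q : rel T := fun x y => g x y || q x y.
Definition add_edge q a b : rel T := fun u v =>
  [|| q u v, (u == a) && (v == b) | (u == b) && (v == a)].
Definition induced S e : rel T := fun x y => [&& x \in S, y \in S & e x y].
Definition no_edge : rel T := fun _ _ => false.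

(** Read in the building direction: a structure on [S] that also respects the virtual edge [ab] is
    extended by [x] to one that respects [q]. The last condition of [elim_deg2] excludes only
    triangles of true edges. *)
Inductive elim g : {set T} -> rel T -> Prop :=
| elim_nil q : elim g set0 q
| elim_deg1 S q x : x \notin S ->
    {in S &, forall y z, adj g q x y -> adj g q x z -> y = z} ->
    elim g S q -> elim g (x |: S) q
| elim_deg2 S q x a b : x \notin S -> a \in S -> b \in S -> a != b ->
    {in S, forall y, adj g q x y -> y = a \/ y = b} ->
    ~~ [&& g x a, g x b & g a b] ->
    elim g S (add_edge q a b) -> elim g (x |: S) q.

Lemma add_edge_sym q a b : symmetric q -> symmetric (add_edge q a b).
Proof.
by move=> qs u v; rewrite /add_edge qs [_ && (v == b) || _]orbC !(andbC (u == _)).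
Qed.

Lemma add_edge_irr q a b : a != b -> irreflexive q -> irreflexive (add_edge q a b).
Proof.
move=> ab qi u; rewrite /add_edge qi andbC orbb.
by case: (eqVneq u a) => [->|_]; rewrite ?(negbTE ab) ?andbF.
Qed.

(** The graph of true and virtual edges stays K4-minor-free: deleting [x] and adding [ab] gives a
    subgraph of the contraction of [xa], in which [a] inherits the edge from [x] to [b]. *)
Lemma elim_induced g S q : simple_graph g -> triangle_free g ->
  symmetric q -> irreflexive q -> ~ has_K4_minor (induced S (adj g q)) -> elim g S q.
Proof.
case=> gs gi tf; move: {2}#|S| (leqnn #|S|) => n.
elim: n S q => [|n IH] S q cS qs qi nK.
  by move: cS; rewrite leqn0 cards_eq0 => /eqP->; apply: elim_nil.
case: (set_0Vmem S) => [->|[x0 x0S]]; first exact: elim_nil.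
set e := induced S (adj g q) in nK.
have es : symmetric e by move=> x y; rewrite /e /induced andbCA /adj gs qs.
have ei : irreflexive e by move=> x; rewrite /e /induced /adj gi qi !andbF.
have eS x y : e x y -> x \in S by case/andP.
have [x xS xdeg] : exists2 x, x \in S & #|nbrs e x| <= 2.
  case: (boolP [forall x in S, 2 < #|nbrs e x|]) => [/forall_inP H|].
    by case: nK; apply: (K4_minor_min_degree es ei eS x0S).
  by case/forall_inPn=> x xS; rewrite -leqNgt; exists x.
have xS' : x \notin S :\ x by rewrite !inE eqxx.
have cS' : #|S :\ x| <= n by move: cS; rewrite (cardsD1 x) xS.
have inS y : y \in S :\ x -> adj g q x y -> y \in nbrs e x.
  by rewrite !inE /e /induced xS => /andP[_ ->].
rewrite -(setD1K xS).
case: (boolP [exists a, exists b, [&& a != b, e x a & e x b]]).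
  case/existsP=> a /existsP[b /and3P[ab exa exb]].
  have nx y : e x y -> y \in S :\ x.
    by rewrite !inE => exy; rewrite (eS y x) 1?es // andbT; apply: contraTneq exy => ->; rewrite ei.
  apply: (elim_deg2 (a := a) (b := b)) => //; try exact: nx.
  - move=> y yS xy; suff : (y == a) || (y == b) by case/orP=> /eqP->; [left | right].
    move: (inS y yS xy); apply: contraLR; rewrite negb_or => /andP[ya yb]; apply/negP=> yN; move: xdeg.
    rewrite (cardsD1 a) (cardsD1 b) (cardsD1 y) !inE ya yb exa exb eq_sym ab.
    by move: yN; rewrite inE => ->.
  - by apply/negP=> /and3P[xa xb gab]; apply: (tf x a b).
  - apply: IH => //; [exact: add_edge_sym | exact: add_edge_irr |] => K; apply: nK.
    apply: (K4_minor_contract es ei exa); apply: K4_minor_mono K => y z.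
    case/and3P=> yS zS yz.
    have yz' : y != z.
      apply: contraTneq yz => ->.
      by rewrite /adj gi (add_edge_irr ab qi).
    have := yS; have := zS; rewrite !inE => /andP[zx zS'] /andP[yx yS'].
    rewrite /contract zx yx yz' /= /e /induced yS' zS' /=.
    have [[xS1 aS xa] [_ bS xb]] := (and3P exa, and3P exb).
    move: yz; rewrite /adj /add_edge orbA; case/orP=> [->//|].
    case/orP=> /andP[/eqP-> /eqP->]; rewrite eqxx /= ?xS1 ?aS ?bS /=.
      by move: xb; rewrite /adj => ->; rewrite !orbT.
    by move: xb; rewrite /adj => ->; rewrite !orbT.
move/existsPn=> H; apply: elim_deg1 => //.
  move=> y z yS zS xy xz; have := inS y yS xy; have := inS z zS xz; rewrite !inE.
  move=> xz' xy'; apply/eqP/negP=> /negP yz; move/existsPn: (H y) => /(_ z).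
  by rewrite yz xy' xz'.
apply: IH => // K; apply: nK; apply: K4_minor_mono K => y z.
by rewrite /e /induced !inE => /and3P[/andP[_ ->] /andP[_ ->] ->].
Qed.

Lemma elim_K4_minor_free g : simple_graph g -> ~ has_K4_minor g -> triangle_free g ->
  elim g setT no_edge.
Proof.
move=> sg nK tf; apply: elim_induced => // K; apply: nK; apply: K4_minor_mono K => x y.
by rewrite /induced /adj orbF => /and3P[].
Qed.

End Elimination.

Lemma cycle_relE n (i j : 'I_n) : 2 < n -> cycle_rel n i j =
  [|| j == i.+1 :> nat, i == j.+1 :> nat, (i == 0 :> nat) && (j == n.-1 :> nat) |
      (j == 0 :> nat) && (i == n.-1 :> nat)].
Proof.
move=> n2; have := ltn_ord i; have := ltn_ord j; rewrite /cycle_rel.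
have M (k : nat) : k < n -> k.+1 %% n = if k.+1 == n then 0 else k.+1.
  by move=> kn; case: eqP => [->|]; [rewrite modnn | move=> ?; apply: modn_small; lia].
by move=> jn iN; rewrite !M //; case: (i.+1 =P n) => E1; case: (j.+1 =P n) => E2; lia.
Qed.

Lemma cycle_simple n : 2 < n -> simple_graph (cycle_rel n).
Proof.
move=> n2; split=> [i j|i]; rewrite !cycle_relE //; last by lia.
by apply/idP/idP; lia.
Qed.

(** Vertices are removed from the largest number down. Among the vertices below [m] a virtual edge
    can only join [0] and [m-1], the two ends of the remaining path. *)
Lemma elim_cycle n : 3 < n -> elim (cycle_rel n) setT (@no_edge _).
Proof.
move=> n3; have n2 : 2 < n by lia.
suff H m (q : rel 'I_n) : m <= n -> symmetric q ->
    (forall u v : 'I_n, u < m -> v < m -> q u v ->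
      (u == 0 :> nat) && (v == m.-1 :> nat) || (v == 0 :> nat) && (u == m.-1 :> nat)) ->
    elim (cycle_rel n) [set i : 'I_n | i < m] q.
  rewrite (_ : setT = [set i : 'I_n | i < n]); last by apply/setP=> i; rewrite !inE ltn_ord.
  exact: H.
elim: m q => [|m IH] q mn qs qm.
  by rewrite (_ : [set _ | _] = set0); [apply: elim_nil | apply/setP=> i; rewrite !inE].
pose x := Ordinal mn.
rewrite (_ : [set _ | _] = x |: [set i : 'I_n | i < m]); last first.
  by apply/setP=> i; rewrite !inE -val_eqE /= ltnS leq_eqVlt.
have xS : x \notin [set i : 'I_n | i < m] by rewrite inE ltnn.
case: (ltnP m 2) => m2.
  apply: elim_deg1 => //; first by move=> y z; rewrite !inE => ym zm _ _; apply: ord_inj; lia.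
  by apply: IH => //; [lia | by move=> u v um vm /qm; lia].
have an : m.-1 < n by lia.
have bn : 0 < n by lia.
apply: (elim_deg2 (a := Ordinal an) (b := Ordinal bn)) => //; rewrite ?inE /=; try lia.
- by rewrite -val_eqE /=; lia.
- move=> y; rewrite inE /adj cycle_relE // /x /= => ym /orP[h|h].
    have [E|E] : y = m.-1 :> nat \/ y = 0 :> nat by lia.
      by left; apply: ord_inj.
    by right; apply: ord_inj.
  by right; apply: ord_inj; have := qm x y; rewrite /x /=; lia.
- by rewrite !cycle_relE //=; lia.
- apply: IH => //; [lia | exact: add_edge_sym |].
  move=> u v um vm /or3P[quv|/andP[/eqP-> /eqP->]|/andP[/eqP-> /eqP->]] /=; try lia.
  by have := qm u v; lia.
Qed.

(** * Extending states along an elimination *)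

Section StateExtension.
Variables (T : finType) (g : rel T) (X : Type) (x0 : X).
Variables (valid : T -> X -> Prop) (R1 R2 : T -> T -> X -> X -> Prop).
Hypotheses (gs : symmetric g) (gi : irreflexive g).
Hypotheses (R1s : forall u v s t, R1 u v s t -> R1 v u t s)
           (R2s : forall u v s t, R2 u v s t -> R2 v u t s)
           (R2r : forall v s, valid v s -> R2 v v s s).
Hypothesis valid_ex : forall v, exists s, valid v s.
(** When both edges at [x] are true, the absence of triangles makes [ab] a purely virtual edge,
    hence [R2]. The two other cases have to start from either relation. *)
Hypothesis ext11 : forall x a b s t, x != a -> x != b -> valid a s -> valid b t ->
  R2 a b s t -> exists r, [/\ valid x r, R1 x a r s & R1 x b r t].
Hypothesis ext12 : forall x a b s t, x != a -> x != b -> valid a s -> valid b t ->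
  R1 a b s t \/ R2 a b s t -> exists r, [/\ valid x r, R1 x a r s & R2 x b r t].
Hypothesis ext22 : forall x a b s t, x != a -> x != b -> valid a s -> valid b t ->
  R1 a b s t \/ R2 a b s t -> exists r, [/\ valid x r, R2 x a r s & R2 x b r t].

Definition good_states (S : {set T}) (q : rel T) (st : T -> X) :=
  {in S, forall v, valid v (st v)} /\
  {in S &, forall u v, (g u v -> R1 u v (st u) (st v)) /\
                       (q u v -> ~~ g u v -> R2 u v (st u) (st v))}.

Lemma good_states_upd (S : {set T}) q x st r : x \notin S -> symmetric q -> irreflexive q ->
  good_states S q st -> valid x r ->
  {in S, forall y, (g x y -> R1 x y r (st y)) /\ (q x y -> ~~ g x y -> R2 x y r (st y))} ->
  good_states (x |: S) q (fun v => if v == x then r else st v).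
Proof.
move=> xS qs qi [sv sR] rv rR; split=> [v|u v]; rewrite !inE.
  by case: eqVneq => [->|_] //=; apply: sv.
case: (eqVneq u x) => [->|ux]; case: (eqVneq v x) => [->|vx] //=.
- by rewrite gi qi.
- by move=> _ vS; apply: rR.
- move=> uS _; rewrite gs qs; have [r1 r2] := rR u uS.
  by split=> [/r1/R1s|/r2 h /h/R2s].
- exact: sR.
Qed.

Lemma elim_good_states S q : elim g S q -> symmetric q -> irreflexive q ->
  exists st, good_states S q st.
Proof.
elim=> {S q} [q|S q x xS nb _ IH|S q x a b xS aS bS ab nb ntri _ IH] qs qi.
- by exists (fun => x0); split=> [v|u v]; rewrite inE.
- have [st gst] := IH qs qi; have [sv sR] := gst.
  have [[a [aS nba]]|no] : (exists a, a \in S /\ {in S, forall y, adj g q x y -> y = a}) \/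
      {in S, forall y, ~~ adj g q x y}.
    case: (boolP [exists a in S, adj g q x a]) => [/exists_inP[a aS xa]|/exists_inPn].
      by left; exists a; split=> // y yS xy; apply: nb.
    by right.
  + have xa : x != a by apply: contraNneq xS => ->.
    (* A single neighbour is treated as the case [a = b]; this is what the reflexivity of [R2] is
       for. *)
    have R2aa := R2r (sv a aS).
    case: (boolP (g x a)) => gxa.
      have [r [rv r1 _]] := ext11 xa xa (sv a aS) (sv a aS) R2aa.
      exists (fun v => if v == x then r else st v); apply: good_states_upd => // y yS.
      split=> [gxy|qxy ngxy]; last first.
        by move: ngxy; rewrite (nba y yS) ?gxa // /adj qxy orbT.
      by rewrite (nba y yS) // /adj gxy.
    have [r [rv r1 _]] := ext22 xa xa (sv a aS) (sv a aS) (or_intror R2aa).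
    exists (fun v => if v == x then r else st v); apply: good_states_upd => // y yS.
    split=> [gxy|qxy ngxy]; last by rewrite (nba y yS) // /adj qxy orbT.
    by move: gxa; rewrite -(nba y yS) ?gxy // /adj gxy.
  + have [r rv] := valid_ex x.
    exists (fun v => if v == x then r else st v); apply: good_states_upd => // y yS.
    by have := no y yS; rewrite negb_or => /andP[/negbTE-> /negbTE->].
have [st gst] := IH (add_edge_sym a b qs) (add_edge_irr ab qi); have [sv sR] := gst.
have xa : x != a by apply: contraNneq xS => ->.
have xb : x != b by apply: contraNneq xS => ->.
have Rab : R1 a b (st a) (st b) \/ R2 a b (st a) (st b).
  have [r1 r2] := sR a b aS bS; case: (boolP (g a b)) => gab; [left | right]; first exact: r1.
  by apply: r2 => //; rewrite /add_edge !eqxx orbT.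
have gst' : good_states S q st.
  split=> // u v uS vS; have [r1 r2] := sR u v uS vS; split=> // quv; apply: r2.
  by rewrite /add_edge quv.
have [r [rv ra rb]] : exists r, [/\ valid x r,
    if g x a then R1 x a r (st a) else R2 x a r (st a) &
    if g x b then R1 x b r (st b) else R2 x b r (st b)].
  have va := sv a aS; have vb := sv b bS.
  case: (boolP (g x a)) => gxa; case: (boolP (g x b)) => gxb.
  - apply: ext11 => //; apply: (sR a b aS bS).2; last by move: ntri; rewrite gxa gxb.
    by rewrite /add_edge !eqxx orbT.
  - exact: ext12.
  - have [|r [rv rb ra]] := ext12 xb xa vb va; last by exists r.
    by case: Rab => [/R1s|/R2s]; [left | right].
  - exact: ext22.
exists (fun v => if v == x then r else st v); apply: good_states_upd => // y yS.
split=> [gxy|qxy /negbTE ngxy].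
  have /nb [//|E|E] : adj g q x y by rewrite /adj gxy.
    by subst y; rewrite gxy in ra.
  by subst y; rewrite gxy in rb.
have /nb [//|E|E] : adj g q x y by rewrite /adj qxy orbT.
  by subst y; rewrite ngxy in ra.
by subst y; rewrite ngxy in rb.
Qed.

End StateExtension.

(** * Finite checks on permutations and partial injections *)

Fixpoint words k n : seq (seq nat) :=
  if n is n'.+1 then [seq c :: w | c <- iota 0 k.+1, w <- words k n'] else [:: [::]].

Lemma mem_words k n w : size w = n -> all (leq^~ k) w -> w \in words k n.
Proof.
elim: n w => [|n IH] [|c w] //= [sw] /andP[ck wk].
apply: (allpairs_f (fun c w => c :: w) (s := iota 0 k.+1)); last exact: IH.
by rewrite mem_iota ltnS.
Qed.

(* A partial injection of [0, k) is coded by the sequence of its values, with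
   [k] at the points where it is undefined. *)
Definition partial_injections k : seq (seq nat) :=
  [seq w <- words k k | uniq [seq c <- w | c != k]].

Definition avoids (p a : seq nat) := all2 (fun x y => x != y) p a.

(** Hall's condition holds: each row and each column keeps at least two of its four entries, so one
    or two rows see two columns, and a column unseen by three rows would have at most one entry
    left. *)
Lemma perm4_avoiding : all (fun a => all (fun b =>
    has (fun p => avoids p a && avoids p b) (permutations (iota 0 4)))
  (partial_injections 4)) (partial_injections 4).
Proof. by vm_compute. Qed.

(* [avoids3] and [noswap3] express, for codes with respect to the list of a new vertex,
   the relations across true and virtual edges. *)
Definition avoids3 (a b : seq nat) := all2 (fun x y => (x != y) || (x == 3)) a b.
Definition noswap3 (a b : seq nat) :=
  all (fun i => all (fun j => [|| i == j, 3 <= nth 0 a i, 3 <= nth 0 a j,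
    nth 0 a i != nth 0 b j | nth 0 a j != nth 0 b i]) (iota 0 3)) (iota 0 3).

(** The clauses correspond to [ext11], [ext12] and [ext22], with all colours read in the list of
    [x]. Colours outside that list become [3], which only weakens what is assumed about [a] and [b],
    so one table serves for all lists. *)
Lemma perm3_extension : all (fun a => all (fun b =>
    [&& noswap3 a b ==> has (fun p => avoids3 p a && avoids3 p b) (permutations (iota 0 3)),
        avoids3 a b || noswap3 a b ==>
          has (fun p => avoids3 p a && noswap3 p b) (permutations (iota 0 3)) &
        avoids3 a b || noswap3 a b ==>
          has (fun p => noswap3 p a && noswap3 p b) (permutations (iota 0 3))])
  (partial_injections 3)) (partial_injections 3).
Proof. by vm_compute. Qed.

Lemma noswap3P a b : noswap3 a b ->
  forall i j, i < 3 -> j < 3 -> i != j -> nth 0 a i < 3 -> nth 0 a j < 3 ->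
  ~~ ((nth 0 a i == nth 0 b j) && (nth 0 a j == nth 0 b i)).
Proof.
move=> /allP ns i j i3 j3 ij ai aj; have := ns i; rewrite mem_iota add0n => /(_ i3).
move=> /allP/(_ j); rewrite mem_iota add0n => /(_ j3).
rewrite ltnNge in ai; rewrite ltnNge in aj.
by rewrite (negbTE ij) (negbTE ai) (negbTE aj) negb_and.
Qed.

Section Codes.
Variables (V : eqType) (x0 : V) (m : rel V) (k : nat) (X A : seq V).
Hypotheses (uX : uniq X) (sX : size X = k) (uA : uniq A) (sA : size A = k).
Hypothesis mX : forall c y y', c \in A -> y \in X -> y' \in X -> m c y -> m c y' -> y = y'.
Hypothesis mA : forall c c' y, c \in A -> c' \in A -> y \in X -> m c y -> m c' y -> c = c'.

(** If [c] has no partner, [find] returns the length [k] of [X], the value reserved for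
    undefined. *)
Definition code := [seq find (m c) X | c <- A].

Lemma size_code : size code = k. Proof. by rewrite size_map. Qed.

Lemma codeE i c : i < k -> c < k -> m (nth x0 A i) (nth x0 X c) = (nth 0 code i == c).
Proof.
move=> ik ck; have Ai : nth x0 A i \in A by rewrite mem_nth ?sA.
have Xc : nth x0 X c \in X by rewrite mem_nth ?sX.
rewrite (nth_map x0) ?sA //; apply/idP/eqP => [mic|E].
  have h : has (m (nth x0 A i)) X by apply/hasP; exists (nth x0 X c).
  apply/eqP; rewrite -(nth_uniq x0 _ _ uX) -?has_find ?sX //.
  apply/eqP; apply: (mX Ai) Xc _ mic; last exact: nth_find.
  by rewrite mem_nth // -has_find.
by rewrite -E; apply: nth_find; rewrite has_find E sX.
Qed.

Lemma code_partial_injection : code \in partial_injections k.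
Proof.
rewrite mem_filter mem_words ?size_code // ?andbT; last first.
  by apply/allP=> _ /mapP[c _ ->]; rewrite -sX find_size.
rewrite filter_map map_inj_in_uniq ?filter_uniq // => c c'.
rewrite !mem_filter /= => /andP[ck cA] /andP[_ c'A] E.
have lt : find (m c) X < size X by rewrite ltn_neqAle sX ck -sX find_size.
have h : has (m c) X by rewrite has_find.
have h' : has (m c') X by rewrite has_find -E.
apply: (mA cA c'A (mem_nth x0 lt)); first exact: nth_find.
by rewrite E; apply: nth_find.
Qed.

End Codes.

Lemma all2_nth (r : rel nat) p a i : all2 r p a -> i < size p -> r (nth 0 p i) (nth 0 a i).
Proof.
elim: p a i => [|x p IH] [|y a] //= [|i] /andP[rxy pa] //= lt.
exact: IH.
Qed.

(** * Packings as compatible orderings of the lists *)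

Section Packing.
Variables (T : finType) (g : rel T) (V : finType) (h : rel V) (L : T -> {set V}).
Hypothesis cov : is_cover g h L.

Lemma cover_matching u v x y y' : u != v -> x \in L u -> y \in L v -> y' \in L v ->
  h x y -> h x y' -> y = y'.
Proof.
case: cov => _ _ _ nadj mat uv xu yv yv'; case: (boolP (g u v)) => guv.
  exact: mat guv xu yv yv'.
by rewrite (negbTE (nadj u v x y uv guv xu yv)).
Qed.

Lemma transversal_of_choice (f : T -> V) : (forall v, f v \in L v) ->
  (forall u v, g u v -> ~~ h (f u) (f v)) -> indep_transversal h L [set f v | v : T].
Proof.
case: cov => [[_ hi] [_ part] _ nadj _] fL nh; split=> [_ _ /imsetP[u _ ->] /imsetP[v _ ->]|v].
  case: (boolP (g u v)) => guv; first exact: nh.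
  case: (eqVneq u v) => [->|uv]; first by rewrite hi.
  exact: (nadj u v _ _ uv guv (fL u) (fL v)).
apply/eqP/cards1P; exists (f v); apply/setP=> x; rewrite !inE.
apply/andP/eqP=> [[/imsetP[u _ ->] uv]|->]; last by rewrite fL imset_f.
by rewrite (part _ _ _ (fL u) uv).
Qed.

(** The [i]-th transversal takes the [i]-th entry of every ordering; distinct positions in an
    ordering make the transversals disjoint. *)
Lemma packing_of_states k (x0 : V) (st : T -> seq V) :
  (forall v, #|L v| = k) ->
  (forall v, perm_eq (st v) (enum (L v))) ->
  (forall u v, g u v -> forall i, i < k -> ~~ h (nth x0 (st u) i) (nth x0 (st v) i)) ->
  has_packing h L k.
Proof.
case: cov => [_ [_ part] _ _ _] Lk perm nh.
have stL v i : i < k -> nth x0 (st v) i \in L v.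
  by move=> ik; rewrite -mem_enum -(perm_mem (perm v)) mem_nth // (perm_size (perm v)) -cardE Lk.
exists (fun i : 'I_k => [set nth x0 (st v) i | v : T]); split=> [i|i j ij].
  by apply: transversal_of_choice => [v|u v guv]; [apply: stL | apply: nh].
rewrite -setI_eq0; apply/eqP/setP=> x; rewrite !inE; apply/negP=> /andP[].
case/imsetP=> u _ -> /imsetP[v _ E].
have Euv : u = v by apply: (part _ _ _ (stL u i (ltn_ord i))); rewrite E; apply: stL.
subst v; move/eqP: E; rewrite nth_uniq ?(perm_size (perm u)) -?cardE ?Lk //.
  by rewrite val_eqE (negbTE ij).
by rewrite (perm_uniq (perm u)) enum_uniq.
Qed.

(** Covers the case in which [nth] has no default element in [V]: the graph then has no vertices
    either. *)
Lemma packing_empty k : 0 < k -> (forall v, #|L v| = k) -> (V -> False) -> has_packing h L k.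
Proof.
move=> k0 Lk noV; exists (fun _ => set0); split=> [i|i j _]; last by rewrite -setI_eq0 set0I.
split=> [x|v]; first by rewrite inE.
by have := Lk v; case: (set_0Vmem (L v)) => [->|[x]//]; rewrite cards0; lia.
Qed.

Section Extension.
Variables (k : nat) (x0 : V).
Hypothesis Lk : forall v, #|L v| = k.

Definition cell_ordering v (s : seq V) := perm_eq s (enum (L v)).

Lemma cell_ordering_size v s : cell_ordering v s -> size s = k.
Proof. by move/perm_size->; rewrite -cardE. Qed.
Lemma cell_ordering_uniq v s : cell_ordering v s -> uniq s.
Proof. by move/perm_uniq->; rewrite enum_uniq. Qed.
Lemma cell_ordering_mem v s : cell_ordering v s -> s =i L v.
Proof. by move/perm_mem=> E x; rewrite E mem_enum. Qed.

Definition reorder x p := [seq nth x0 (enum (L x)) c | c <- p].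

Lemma reorder_ordering x p : perm_eq p (iota 0 k) -> cell_ordering x (reorder x p).
Proof.
move=> pk; rewrite /cell_ordering (permPl (perm_map _ pk)).
have E : k = size (enum (L x)) by rewrite -cardE.
by rewrite {1}E map_nth_iota0 // take_size.
Qed.

Lemma nth_reorder x p i : i < size p -> nth x0 (reorder x p) i = nth x0 (enum (L x)) (nth 0 p i).
Proof. by move=> ip; rewrite (nth_map 0). Qed.

End Extension.
End Packing.

Theorem c_packing4_of_elim (T : finType) (g : rel T) :
  simple_graph g -> elim g setT (@no_edge T) -> P_c_star g 4.
Proof.
case=> gs gi el V h L [cov Lk]; have [[hs hi] _ _ _ _] := cov.
case: (pickP V) => [x0 _|noV]; last by apply: packing_empty => // x; have := noV x.
pose R1 (u v : T) (s t : seq V) := forall i, i < 4 -> ~~ h (nth x0 s i) (nth x0 t i).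
pose R2 (u v : T) (s t : seq V) := True.
have ext x a b s t : x != a -> x != b -> cell_ordering L a s -> cell_ordering L b t ->
    exists r, [/\ cell_ordering L x r, R1 x a r s & R1 x b r t].
  move=> xa xb sa tb.
  have pinj c w : x != c -> cell_ordering L c w -> code h (enum (L x)) w \in partial_injections 4.
    move=> xc cw; apply: (code_partial_injection x0).
    - by rewrite -cardE Lk.
    - exact: cell_ordering_uniq cw.
    - exact: (cell_ordering_size Lk cw).
    - move=> y y' z; rewrite !(cell_ordering_mem cw) mem_enum => yc yc' zx.
      by rewrite ![h _ z]hs; apply: (cover_matching cov xc).
  have [p] := hasP (allP (allP perm4_avoiding _ (pinj a s xa sa)) _ (pinj b t xb tb)).
  rewrite mem_permutations => pp /andP[pa pb]; have sp := perm_size pp; rewrite size_iota in sp.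
  exists (reorder L x0 x p).
  have R1c c w : x != c -> cell_ordering L c w -> avoids p (code h (enum (L x)) w) ->
      R1 x c (reorder L x0 x p) w.
    move=> xc cw pc i i4; rewrite nth_reorder ?sp // hs.
    have pi4 : nth 0 p i < 4.
      have : nth 0 p i \in p by rewrite mem_nth ?sp.
      by rewrite (perm_mem pp) mem_iota.
    rewrite (@codeE _ x0 h 4) ?enum_uniq -?cardE ?Lk ?(cell_ordering_size Lk cw) //.
      by rewrite eq_sym; apply: (all2_nth pc); rewrite sp.
    move=> y z z'; rewrite (cell_ordering_mem cw) !mem_enum.
    by apply: (cover_matching cov); rewrite eq_sym.
  by split; [apply: (reorder_ordering x0 Lk) | apply: R1c | apply: R1c].
have [st [sv sR]] : exists st, good_states g (cell_ordering L) R1 R2 setT (@no_edge T) st.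
  apply: (elim_good_states [::] gs gi) el _ _ => //.
  - by move=> u v s t st i i4; rewrite hs; apply: st.
  - by move=> v; exists (enum (L v)); apply: perm_refl.
  - by move=> x a b s t xa xb sa sb _; apply: ext.
  - by move=> x a b s t xa xb sa sb _; have [r [rx ra _]] := ext x a b s t xa xb sa sb; exists r.
  - by move=> x a b s t xa xb sa sb _; have [r [rx ra _]] := ext x a b s t xa xb sa sb; exists r.
apply: (packing_of_states cov (st := st) (x0 := x0) Lk) => [v|u v guv]; first exact: sv.
by apply: (sR u v _ _).1.
Qed.

Theorem l_packing3_of_elim (T : finType) (g : rel T) :
  simple_graph g -> elim g setT (@no_edge T) -> P_l_star g 3.
Proof.
case=> gs gi el V h L [cov Lk] [_ [lab [labI hlab]]]; have [[hs hi] [_ part] _ _ _] := cov.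
case: (pickP V) => [x0 _|noV]; last by apply: packing_empty => // x; have := noV x.
(* Colours must be compared across virtual edges as well, where [h] may have no edges; hence [m] in
   place of [h]. *)
pose m : rel V := fun x y => lab x == lab y.
have ms : symmetric m by move=> x y; rewrite /m eq_sym.
pose R1 (u v : T) (s t : seq V) := forall i, i < 3 -> ~~ m (nth x0 s i) (nth x0 t i).
pose R2 (u v : T) (s t : seq V) := forall i j, i < 3 -> j < 3 -> i != j ->
  ~~ (m (nth x0 s i) (nth x0 t j) && m (nth x0 s j) (nth x0 t i)).
have mcell c x s y z z' : cell_ordering L c s -> y \in s -> z \in enum (L x) ->
    z' \in enum (L x) -> m y z -> m y z' -> z = z'.
  by rewrite !mem_enum => _ _ zx zx' /eqP E /eqP E'; apply: (labI x) => //; rewrite -E.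
have mcell' c x s y y' z : cell_ordering L c s -> y \in s -> y' \in s ->
    z \in enum (L x) -> m y z -> m y' z -> y = y'.
  move=> cs; rewrite !(cell_ordering_mem cs) => yc yc' _ /eqP E /eqP E'.
  by apply: (labI c) => //; rewrite E.
pose cd x s := code m (enum (L x)) s.
have pinj x c s : cell_ordering L c s -> cd x s \in partial_injections 3.
  move=> cs; apply: (code_partial_injection x0).
  - by rewrite -cardE Lk.
  - exact: cell_ordering_uniq cs.
  - exact: (cell_ordering_size Lk cs).
  - by move=> y y' z; apply: mcell' cs.
have cdE x c s i j : cell_ordering L c s -> i < 3 -> j < 3 ->
    m (nth x0 s i) (nth x0 (enum (L x)) j) = (nth 0 (cd x s) i == j).
  move=> cs i3 j3; apply: (@codeE _ x0 m 3);
    rewrite ?enum_uniq -?cardE ?Lk ?(cell_ordering_size Lk cs) //.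
  by move=> y z z'; apply: mcell cs.
have R2_noswap x a b s t : cell_ordering L a s -> cell_ordering L b t -> R2 a b s t ->
    noswap3 (cd x s) (cd x t).
  move=> sa tb st; apply/allP=> i; rewrite mem_iota => /andP[_ i3].
  apply/allP=> j; rewrite mem_iota => /andP[_ j3]; rewrite add0n in i3 j3.
  case: (eqVneq i j) => [//|ij]; rewrite orFb.
  case: (leqP 3 (nth 0 (cd x s) i)) => [//|ci]; rewrite orFb.
  case: (leqP 3 (nth 0 (cd x s) j)) => [//|cj]; rewrite orFb.
  rewrite -negb_and; apply: contra (st i j i3 j3 ij) => /andP[/eqP E1 /eqP E2].
  have := cdE x _ _ _ _ sa i3 ci; have := cdE x _ _ _ _ sa j3 cj.
  have := cdE x _ _ _ _ tb j3 ci; have := cdE x _ _ _ _ tb i3 cj.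
  rewrite !eqxx -E1 -E2 !eqxx /m => /eqP h4 /eqP h3 /eqP h2 /eqP h1.
  by rewrite h1 h2 h3 h4 !eqxx.
have R1_avoids x a b s t : cell_ordering L a s -> cell_ordering L b t -> R1 a b s t ->
    avoids3 (cd x s) (cd x t).
  move=> sa tb st; rewrite /avoids3 all2E !size_map !(cell_ordering_size Lk sa, cell_ordering_size Lk tb) /=.
  apply/(all_nthP (0, 0)) => i; rewrite size_zip !size_map.
  rewrite !(cell_ordering_size Lk sa, cell_ordering_size Lk tb) minnn => i3.
  rewrite nth_zip /=; last by rewrite !size_map !(cell_ordering_size Lk sa, cell_ordering_size Lk tb).
  case: eqVneq => //= E; case: (ltngtP (nth 0 (cd x s) i) 3) => // ci.
    have h1 := cdE x _ _ _ _ sa i3 ci; have h2 := cdE x _ _ _ _ tb i3 ci.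
    rewrite eqxx in h1; rewrite -E eqxx in h2.
    by have := st i i3; rewrite /m (eqP h1) (eqP h2) eqxx.
  move: ci; rewrite (nth_map x0) ?(cell_ordering_size Lk sa) // ltnNge -(Lk x) cardE.
  by rewrite find_size.
have sound x p c s : cell_ordering L c s -> perm_eq p (iota 0 3) ->
    (avoids3 p (cd x s) -> R1 x c (reorder L x0 x p) s) /\
    (noswap3 p (cd x s) -> R2 x c (reorder L x0 x p) s).
  move=> cs pp; have sp := perm_size pp; rewrite size_iota in sp.
  have p3 i : i < 3 -> nth 0 p i < 3.
    move=> i3; have : nth 0 p i \in p by rewrite mem_nth ?sp.
    by rewrite (perm_mem pp) mem_iota.
  have mE i j : i < 3 -> j < 3 ->
      m (nth x0 (reorder L x0 x p) i) (nth x0 s j) = (nth 0 (cd x s) j == nth 0 p i).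
    by move=> i3 j3; rewrite ms nth_reorder ?sp // (cdE x c) // p3.
  split=> [av i i3|ns i j i3 j3 ij].
    rewrite mE // eq_sym; have := @all2_nth _ _ _ i av; rewrite sp => /(_ i3).
    by case/orP=> // /eqP E; have := p3 i i3; rewrite E.
  rewrite !mE //; apply: contra (noswap3P ns i3 j3 ij (p3 i i3) (p3 j j3)).
  by case/andP=> /eqP-> /eqP->; rewrite !eqxx.
have [st [sv sR]] : exists st, good_states g (cell_ordering L) R1 R2 setT (@no_edge T) st.
  apply: (elim_good_states [::] gs gi) el _ _ => //.
  - by move=> u v s t st i i3; rewrite ms; apply: st.
  - by move=> u v s t st i j i3 j3 ij; rewrite ![m (nth x0 t _) _]ms andbC; apply: st.
  - move=> v s vs i j i3 j3 ij; apply/negP=> /andP[/eqP mij _].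
    have := ij; rewrite -(nth_uniq x0 _ _ (cell_ordering_uniq vs)) ?(cell_ordering_size Lk vs) //.
    rewrite (labI v _ _ _ _ mij) ?eqxx // -(cell_ordering_mem vs) mem_nth //.
      by rewrite (cell_ordering_size Lk vs).
    by rewrite (cell_ordering_size Lk vs).
  - by move=> v; exists (enum (L v)); apply: perm_refl.
  - move=> x a b s t xa xb sa tb st.
    have /and3P[+ _ _] := allP (allP perm3_extension _ (pinj x a s sa)) _ (pinj x b t tb).
    rewrite (R2_noswap x a b) // implyTb => /hasP[p]; rewrite mem_permutations => pp /andP[pa pb].
    exists (reorder L x0 x p); split; first exact: (reorder_ordering x0 Lk).
      exact: (sound x p a s sa pp).1.
    exact: (sound x p b t tb pp).1.
  - move=> x a b s t xa xb sa tb st.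
    have /and3P[_ + _] := allP (allP perm3_extension _ (pinj x a s sa)) _ (pinj x b t tb).
    have -> : avoids3 (cd x s) (cd x t) || noswap3 (cd x s) (cd x t).
      by apply/orP; case: st => st; [left; apply: (R1_avoids x a b) | right; apply: (R2_noswap x a b)].
    rewrite implyTb => /hasP[p]; rewrite mem_permutations => pp /andP[pa pb].
    exists (reorder L x0 x p); split; first exact: (reorder_ordering x0 Lk).
      exact: (sound x p a s sa pp).1.
    exact: (sound x p b t tb pp).2.
  - move=> x a b s t xa xb sa tb st.
    have /and3P[_ _ +] := allP (allP perm3_extension _ (pinj x a s sa)) _ (pinj x b t tb).
    have -> : avoids3 (cd x s) (cd x t) || noswap3 (cd x s) (cd x t).
      by apply/orP; case: st => st; [left; apply: (R1_avoids x a b) | right; apply: (R2_noswap x a b)].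
    rewrite implyTb => /hasP[p]; rewrite mem_permutations => pp /andP[pa pb].
    exists (reorder L x0 x p); split; first exact: (reorder_ordering x0 Lk).
      exact: (sound x p a s sa pp).2.
    exact: (sound x p b t tb pp).2.
apply: (packing_of_states cov (st := st) (x0 := x0) Lk) => [v|u v guv i i3]; first exact: sv.
have uv : u != v by apply: contraTneq guv => ->; rewrite gi.
have inL w : nth x0 (st w) i \in L w.
  by rewrite -(cell_ordering_mem (sv w (in_setT w))) mem_nth // (cell_ordering_size Lk (sv w (in_setT w))).
rewrite (hlab u v) // guv /=.
by apply: (sR u v _ _).1.
Qed.

(** * Fractional packings *)

Definition perms3 := permutations (iota 0 3).
(* 18 times the joint probability of the colours [i] and [j]: uniform on the pairs
   outside the graph of a permutation [s], or independent and uniform. *)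
Definition law_weight (t : option (seq nat)) (i j : nat) : nat :=
  if t is Some s then (if j == nth 0 s i then 0 else 3) else 2.

(* The colour of a new vertex given the colours [p], [r] of its neighbours, as a function
   of a uniform [i] in [0, 6); [t] is the law of the two neighbours, [ta] and [tb] the
   required laws of the new vertex with each of them. *)
Definition kernel (ta tb t : option (seq nat)) (p r i : nat) : nat :=
  match ta, tb, t with
  | Some sa, Some sb, _ =>
      let fa := index p sa in let fb := index r sb in
      if fa == fb then (fa + (if i < 3 then 1 else 2)) %% 3 else 3 - fa - fb
  | Some sa, None, None => (index p sa + (if i < 3 then 1 else 2)) %% 3
  | Some sa, None, Some s =>
      let u := index p sa in let w := index (index r s) sa in
      if i < 2 then w else (6 - u - w) %% 3
  | None, Some sb, None => (index r sb + (if i < 3 then 1 else 2)) %% 3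
  | None, Some sb, Some s =>
      let u := index r sb in let w := index (nth 0 s p) sb in
      if i < 2 then w else (6 - u - w) %% 3
  | None, None, _ => i %% 3
  end.

Definition kernel_count ta tb t p r q := count (fun i => kernel ta tb t p r i == q) (iota 0 6).

Definition laws := None :: map Some perms3.

(** If [xa] and [xb] are true, then given [p] the colour forbidden by [r] is uniform, so the new
    colour is uniform on the two left by [p]. If [xa] and [ab] are true and [xb] is virtual, [w] is
    the colour of [x] matched to the colour of [a] that [r] rules out; giving probability 1/3 to [w]
    and 2/3 to the third colour makes [x] independent of [b]. The case set aside is a triangle of
    true edges. *)
Lemma kernelP : all (fun ta => all (fun tb => all (fun t =>
    [&& isSome ta, isSome tb & isSome t] ||
    all (fun p => all (fun q =>
      [&& all (fun i => kernel ta tb t p q i < 3) (iota 0 6),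
        sumn [seq law_weight t p r * kernel_count ta tb t p r q | r <- iota 0 3]
          == 6 * law_weight ta q p &
        sumn [seq law_weight t r p * kernel_count ta tb t r p q | r <- iota 0 3]
          == 6 * law_weight tb q p]) (iota 0 3)) (iota 0 3)) laws) laws) laws.
Proof. by vm_compute. Qed.

(** With the other two laws [None] the kernel ignores [r], so a vertex with one neighbour [a] can
    use [a] twice. *)
Lemma kernel1P : all (fun ta => all (fun p => all (fun r => all (fun q =>
    kernel_count ta None None p r q == law_weight ta q p)
  (iota 0 3)) (iota 0 3)) (iota 0 3)) laws.
Proof. by vm_compute. Qed.

(** Each matching is completed to a permutation; forbidding the added pairs too gives all true edges
    laws of the same shape. *)
Lemma partial_injection3_extends : all (fun a => has (fun s =>
    all2 (fun x y => (x == 3) || (x == y)) a s) perms3) (partial_injections 3).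
Proof. by vm_compute. Qed.

Definition perm_inv (s : seq nat) := [seq index i s | i <- iota 0 3].

Lemma perm3_inv : all (fun s => (perm_inv s \in perms3) && all (fun i => all (fun j =>
    (j == nth 0 s i) == (i == nth 0 (perm_inv s) j)) (iota 0 3)) (iota 0 3)) perms3.
Proof. by vm_compute. Qed.

Lemma law_weight_sum : all (fun t => all (fun q =>
    sumn [seq law_weight t q p | p <- iota 0 3] == 6) (iota 0 3)) laws.
Proof. by vm_compute. Qed.

Lemma mem_iota0 n i : (i \in iota 0 n) = (i < n).
Proof. by rewrite mem_iota. Qed.

Lemma sumn_iota (f : nat -> nat) n : sumn [seq f i | i <- iota 0 n] = \sum_(i < n) f i.
Proof. by rewrite sumnE big_map -(big_mkord xpredT) /index_iota subn0. Qed.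

Lemma count_iota (P : pred nat) n : count P (iota 0 n) = \sum_(i < n) P i.
Proof. by rewrite -sumn_count sumn_iota. Qed.

(** * Joint laws as counts over a finite sample space *)

Section Laws.
Variables (T : finType).

Definition freq (O : finType) (c : O -> T -> nat) u i := \sum_(o : O) (c o u == i).
Definition joint (O : finType) (c : O -> T -> nat) u v i j :=
  \sum_(o : O) ((c o u == i) && (c o v == j)).
(** The probabilities are 0, 1/6 and 1/9, whence the common denominator 18; counting outcomes keeps
    the argument in [nat]. *)
Definition has_law (O : finType) (c : O -> T -> nat) t u v :=
  forall i j, i < 3 -> j < 3 -> joint c u v i j * 18 = law_weight t i j * #|O|.

Lemma has_law_sym (O : finType) (c : O -> T -> nat) s u v : s \in perms3 ->
  has_law c (Some s) u v -> has_law c (Some (perm_inv s)) v u.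
Proof.
move=> sp law i j i3 j3; have := law j i j3 i3; rewrite /joint.
under eq_bigr do rewrite andbC; move=> ->; rewrite /law_weight.
have /andP[_ /allP/(_ j)] := allP perm3_inv _ sp.
by rewrite mem_iota0 => /(_ j3)/allP/(_ i); rewrite mem_iota0 => /(_ i3)/eqP->.
Qed.

Lemma has_law_None_sym (O : finType) (c : O -> T -> nat) u v :
  has_law c None u v -> has_law c None v u.
Proof.
move=> law i j i3 j3; have := law j i j3 i3; rewrite /joint.
by under eq_bigr do rewrite andbC.
Qed.

Section Extend.
Variables (O : finType) (c : O -> T -> nat) (x : T) (F : nat -> nat -> nat -> nat) (a b : T).
Hypothesis c3 : forall o v, c o v < 3.
Hypotheses (xa : x != a) (xb : x != b).

(** The sample space is multiplied by an independent uniform choice in ['I_6], from which the kernel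
    draws both halves and thirds. *)
Definition extend (w : O * 'I_6) v := if v == x then F (c w.1 a) (c w.1 b) w.2 else c w.1 v.

Lemma sum_extend (f : O -> 'I_6 -> nat) : \sum_(w : O * 'I_6) f w.1 w.2 = \sum_o \sum_i f o i.
Proof. by rewrite (pair_big xpredT xpredT f). Qed.

Lemma card_extend : #|{: O * 'I_6}| = 6 * #|O|.
Proof. by rewrite card_prod card_ord mulnC. Qed.

Lemma freq_extend v i : v != x -> freq extend v i = 6 * freq c v i.
Proof.
move=> vx; rewrite /freq /extend (negbTE vx) (sum_extend (fun o _ => c o v == i)).
by under eq_bigr do rewrite sum_nat_const card_ord; rewrite big_distrr.
Qed.

Lemma joint_extend u v i j : u != x -> v != x -> joint extend u v i j = 6 * joint c u v i j.
Proof.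
move=> ux vx; rewrite /joint /extend (negbTE ux) (negbTE vx).
rewrite (sum_extend (fun o _ => (c o u == i) && (c o v == j))).
by under eq_bigr do rewrite sum_nat_const card_ord; rewrite big_distrr.
Qed.

Lemma has_law_extend t u v : u != x -> v != x -> has_law c t u v -> has_law extend t u v.
Proof.
by move=> ux vx law i j i3 j3; rewrite joint_extend // card_extend -mulnA law // mulnCA.
Qed.

Let K p r q := \sum_(i < 6) (F p r i == q).

Lemma joint_extend_l q p : joint extend x a q p = \sum_(r < 3) joint c a b p r * K p r q.
Proof.
rewrite /joint /extend eqxx eq_sym (negbTE xa).
rewrite (sum_extend (fun o i => (F (c o a) (c o b) i == q) && (c o a == p))).
under [RHS]eq_bigr do rewrite big_distrl /=.
rewrite [RHS]exchange_big /=; apply: eq_bigr => o _.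
rewrite [RHS](bigD1 (Ordinal (c3 o b))) //= eqxx andbT [in RHS]big1 ?addn0 => [|r rb]; last first.
  by rewrite [c o b == r]eq_sym -[_ == c o b]/(val r == val (Ordinal (c3 o b))) val_eqE (negbTE rb) andbF.
rewrite /K; case: (eqVneq (c o a) p) => [->|_]; first by rewrite mul1n; apply: eq_bigr => i _; rewrite andbT.
by rewrite mul0n big1 // => i _; rewrite andbF.
Qed.

Lemma joint_extend_r q r : joint extend x b q r = \sum_(p < 3) joint c a b p r * K p r q.
Proof.
rewrite /joint /extend eqxx eq_sym (negbTE xb).
rewrite (sum_extend (fun o i => (F (c o a) (c o b) i == q) && (c o b == r))).
under [RHS]eq_bigr do rewrite big_distrl /=.
rewrite [RHS]exchange_big /=; apply: eq_bigr => o _.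
rewrite [RHS](bigD1 (Ordinal (c3 o a))) //= eqxx [in RHS]big1 ?addn0 => [|p pa]; last first.
  by rewrite [c o a == p]eq_sym -[_ == c o a]/(val p == val (Ordinal (c3 o a))) val_eqE (negbTE pa).
rewrite /K; case: (eqVneq (c o b) r) => [->|_]; first by rewrite mul1n; apply: eq_bigr => i _; rewrite andbT.
by rewrite mul0n big1 // => i _; rewrite andbF.
Qed.

End Extend.
End Laws.

Lemma Some_laws s : s \in perms3 -> Some s \in laws.
Proof. by move=> sp; rewrite in_cons map_f. Qed.

Lemma kernel_table ta tb t p q : ta \in laws -> tb \in laws -> t \in laws ->
  ~~ [&& isSome ta, isSome tb & isSome t] -> p < 3 -> q < 3 ->
  [/\ forall i, i < 6 -> kernel ta tb t p q i < 3,
   \sum_(r < 3) law_weight t p r * kernel_count ta tb t p r q = 6 * law_weight ta q p &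
   \sum_(r < 3) law_weight t r p * kernel_count ta tb t r p q = 6 * law_weight tb q p].
Proof.
move=> tal tbl tl nsome p3 q3.
have := allP (allP (allP kernelP _ tal) _ tbl) _ tl; rewrite (negbTE nsome) orFb => /allP/(_ p).
rewrite mem_iota0 => /(_ p3)/allP/(_ q).
rewrite mem_iota0 => /(_ q3)/and3P[/allP k3 /eqP k1 /eqP k2]; split.
- by move=> i i6; apply: k3; rewrite mem_iota0.
- by rewrite -k1 (sumn_iota (fun r => law_weight t p r * kernel_count ta tb t p r q)).
- by rewrite -k2 (sumn_iota (fun r => law_weight t r p * kernel_count ta tb t r p q)).
Qed.

Section KernelLaws.
Variables (T : finType) (O : finType) (c : O -> T -> nat) (x : T).
Hypothesis c3 : forall o v, c o v < 3.

Lemma freq_of_law t a i : t \in laws -> i < 3 -> has_law c t x a -> freq c x i * 3 = #|O|.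
Proof.
move=> tl i3 law.
have -> : freq c x i = \sum_(p < 3) joint c x a i p.
  rewrite /joint exchange_big; apply: eq_bigr => o _.
  rewrite (bigD1 (Ordinal (c3 o a))) //= eqxx andbT big1 ?addn0 // => p pa.
  by rewrite [c o a == p]eq_sym -[_ == c o a]/(val p == val (Ordinal (c3 o a))) val_eqE (negbTE pa) andbF.
suff : (\sum_(p < 3) joint c x a i p) * 18 = 6 * #|O| by lia.
rewrite big_distrl /=; under eq_bigr do rewrite law //.
rewrite -big_distrl /= -(sumn_iota (law_weight t i)).
by have /allP/(_ i) := allP law_weight_sum _ tl; rewrite mem_iota0 => /(_ i3)/eqP->.
Qed.

Lemma kernel_laws ta tb t a b : x != a -> x != b ->
  ta \in laws -> tb \in laws -> t \in laws -> ~~ [&& isSome ta, isSome tb & isSome t] ->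
  has_law c t a b ->
  let c' := extend c x (kernel ta tb t) a b in
  [/\ has_law c' ta x a, has_law c' tb x b & forall o v, c' o v < 3].
Proof.
move=> xa xb tal tbl tl nsome law /=.
have K p q := @kernel_table ta tb t p q tal tbl tl nsome.
split.
- move=> q p q3 p3; have [_ k _] := K p q p3 q3.
  rewrite joint_extend_l // card_extend mulnA [_ * 6]mulnC -k !big_distrl /=.
  apply: eq_bigr => r _; rewrite mulnAC law // mulnAC; congr (_ * _ * _).
  by rewrite /kernel_count count_iota.
- move=> q p q3 p3; have [_ _ k] := K p q p3 q3.
  rewrite joint_extend_r // card_extend mulnA [_ * 6]mulnC -k !big_distrl /=.
  apply: eq_bigr => r _; rewrite mulnAC law // mulnAC; congr (_ * _ * _).
  by rewrite /kernel_count count_iota.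
- move=> o v; rewrite /extend; case: ifP => // _.
  by have [k _ _] := K _ _ (c3 o.1 a) (c3 o.1 b); apply: k.
Qed.

Lemma kernel1_laws ta a : x != a -> ta \in laws ->
  (forall i, i < 3 -> freq c a i * 3 = #|O|) ->
  let c' := extend c x (kernel ta None None) a a in
  has_law c' ta x a /\ forall o v, c' o v < 3.
Proof.
move=> xa tal fr /=; split; last first.
  move=> o v; rewrite /extend; case: ifP => // _.
  have ns : ~~ [&& isSome ta, isSome (@None (seq nat)) & isSome (@None (seq nat))] by rewrite andbF.
  have N0 : None \in laws by rewrite inE.
  by have [k _ _] := kernel_table tal N0 N0 ns (c3 o.1 a) (c3 o.1 a); apply: k.
move=> q p q3 p3; rewrite joint_extend_l // card_extend.
have k r : r < 3 -> \sum_(i < 6) (kernel ta None None p r i == q) = law_weight ta q p.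
  move=> r3; have := allP (allP kernel1P _ tal) p; rewrite mem_iota0 => /(_ p3)/allP/(_ r).
  rewrite mem_iota0 => /(_ r3)/allP/(_ q); rewrite mem_iota0 => /(_ q3)/eqP<-.
  by rewrite /kernel_count count_iota.
under eq_bigr do rewrite k //.
rewrite -big_distrl /=; have -> : \sum_(r < 3) joint c a a p r = freq c a p.
  rewrite /joint exchange_big; apply: eq_bigr => o _.
  rewrite (bigD1 (Ordinal (c3 o a))) //= eqxx andbT big1 ?addn0 // => r ra.
  by rewrite [c o a == r]eq_sym -[_ == c o a]/(val r == val (Ordinal (c3 o a))) val_eqE (negbTE ra) andbF.
by rewrite -(fr p p3); move: (freq _ _ _) (law_weight _ _ _) => f w; lia.
Qed.

End KernelLaws.

Section Fractional.
Variables (T : finType) (g : rel T) (V : finType) (h : rel V) (L : T -> {set V}) (x0 : V).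
Hypotheses (gs : symmetric g) (gi : irreflexive g) (cov : is_cover g h L).
Hypothesis L3 : forall v, #|L v| = 3.

Definition cell v i := nth x0 (enum (L v)) i.
Definition compat u v (s : seq nat) :=
  forall i j, i < 3 -> j < 3 -> h (cell u i) (cell v j) -> j = nth 0 s i.
Definition edge_law (O : finType) (c : O -> T -> nat) u v :=
  exists s, [/\ s \in perms3, compat u v s & has_law c (Some s) u v].

Lemma edge_law_sym (O : finType) (c : O -> T -> nat) u v : edge_law c u v -> edge_law c v u.
Proof.
have [[hs _] _ _ _ _] := cov.
case=> s [sp cs law]; have /andP[ip /allP H] := allP perm3_inv _ sp.
exists (perm_inv s); split=> //; last exact: has_law_sym.
move=> i j i3 j3; rewrite hs => /(cs j i j3 i3)/eqP E.
have := H j; rewrite mem_iota0 => /(_ j3)/allP/(_ i); rewrite mem_iota0 => /(_ i3).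
by rewrite E => /eqP/esym/eqP.
Qed.

Lemma compat_ex u v : u != v -> exists2 s, s \in perms3 & compat u v s.
Proof.
move=> uv; have [[hs _] _ _ _ _] := cov; pose a := code h (enum (L v)) (enum (L u)).
have mX : forall c y y', c \in enum (L u) -> y \in enum (L v) -> y' \in enum (L v) ->
    h c y -> h c y' -> y = y'.
  by move=> c y y'; rewrite !mem_enum; apply: (cover_matching cov).
have pa : a \in partial_injections 3.
  apply: (code_partial_injection x0); rewrite ?enum_uniq -?cardE ?L3 //.
  move=> y y' z; rewrite !mem_enum ![h _ z]hs => yu yu' zv.
  by apply: (cover_matching cov) zv yu yu'; rewrite eq_sym.
have [s sp as_] := hasP (allP partial_injection3_extends _ pa).
exists s => // i j i3 j3; rewrite /cell (@codeE _ x0 h 3) ?enum_uniq -?cardE ?L3 // => /eqP E.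
have := all2_nth (r := fun x y => (x == 3) || (x == y)) as_ (i := i).
rewrite size_map -cardE L3 => /(_ i3); rewrite E => /orP[/eqP j3'|/eqP//].
by rewrite j3' in j3.
Qed.

Lemma law_choice u v : u != v -> exists t, [/\ t \in laws, isSome t = g u v &
  forall (O : finType) (c : O -> T -> nat), has_law c t u v ->
    (g u v -> edge_law c u v) /\ (~~ g u v -> has_law c None u v)].
Proof.
move=> uv; case: (boolP (g u v)) => guv; last by exists None; split.
have [s sp cs] := compat_ex uv; exists (Some s); split; [exact: Some_laws | by [] |].
by move=> O c law; split=> // _; exists s.
Qed.

(** The state is a single coupling of all colours, not one state per vertex, so the induction on
    [elim] is carried out anew. Only pair laws inside [S] are recorded; the marginals are uniform at
    every vertex. *)
Definition frac_state (S : {set T}) (q : rel T) (O : finType) (c : O -> T -> nat) :=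
  [/\ 0 < #|O|, forall o v, c o v < 3, forall v i, i < 3 -> freq c v i * 3 = #|O| &
     {in S &, forall u v, (g u v -> edge_law c u v) /\
                          (q u v -> ~~ g u v -> has_law c None u v)}].

Lemma frac_state_extend (S : {set T}) (q : rel T) x F a b (O : finType) (c : O -> T -> nat) t d :
  x \notin S -> symmetric q -> irreflexive q -> x != a -> x != b -> frac_state S q c ->
  let c' := extend c x F a b in
  (forall o v, c' o v < 3) -> t \in laws -> has_law c' t x d ->
  {in S, forall y, (g x y -> edge_law c' x y) /\ (q x y -> ~~ g x y -> has_law c' None x y)} ->
  frac_state (x |: S) q c'.
Proof.
move=> xS qs qi xa xb [O0 c3 fr sR] c' c'3 tl law xR; split=> //.
- by rewrite card_extend; lia.
- move=> v i i3; case: (eqVneq v x) => [->|vx]; first exact: freq_of_law law.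
  by rewrite freq_extend // card_extend -mulnA fr.
move=> u v; rewrite !inE.
case: (eqVneq u x) => [->|ux]; case: (eqVneq v x) => [->|vx] //=.
- by rewrite gi qi.
- by move=> _ vS; apply: xR.
- move=> uS _; rewrite gs qs; have [r1 r2] := xR u uS.
  by split=> [/r1/edge_law_sym|/r2 r /r/has_law_None_sym].
- move=> uS vS; have [r1 r2] := sR u v uS vS; split=> [/r1[s [sp cs lw]]|quv nguv].
    by exists s; split=> //; apply: has_law_extend.
  by apply: has_law_extend => //; apply: r2.
Qed.

Lemma elim_frac_state S q : elim g S q -> symmetric q -> irreflexive q ->
  exists (O : finType) (c : O -> T -> nat), frac_state S q c.
Proof.
elim=> {S q} [q|S q x xS nb _ IH|S q x a b xS aS bS ab nb ntri _ IH] qs qi.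
(* A placeholder for the empty set: one uniform colour shared by all vertices. *)
- exists 'I_3, (fun o _ => val o); split.
  + by rewrite card_ord.
  + by move=> o _; apply: ltn_ord.
  + move=> v i i3; rewrite /freq card_ord (bigD1 (Ordinal i3)) //= eqxx big1 // => o.
    by rewrite -val_eqE /= => /negbTE->.
  + by move=> u v; rewrite inE.
- have [O [c st]] := IH qs qi; have [O0 c3 fr sR] := st.
  case: (boolP [exists a in S, adj g q x a]) => [/exists_inP[a aS xa]|/exists_inPn no].
    have nx : x != a by apply: contraNneq xS => ->.
    have [t [tl tg tlaw]] := law_choice nx.
    have [law c'3] := kernel1_laws c3 nx tl (fr a).
    exists _, (extend c x (kernel t None None) a a).
    apply: (frac_state_extend xS qs qi nx nx st c'3 tl law) => y yS.
    have [r1 r2] := tlaw _ _ law.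
    split=> [gxy|qxy ngxy]; have E : y = a by apply: nb => //; rewrite /adj ?gxy ?qxy ?orbT.
      by rewrite E in gxy *; apply: r1.
    by rewrite E in ngxy *; apply: r2.
  exists O, c; split=> // u v; rewrite !inE.
  have no' y : y \in S -> g x y = false /\ q x y = false.
    by move=> yS; have := no y yS; rewrite negb_or => /andP[/negbTE-> /negbTE->].
  case: (eqVneq u x) => [->|ux]; case: (eqVneq v x) => [->|vx] //=.
  + by rewrite gi qi.
  + by move=> _ /no'[-> ->].
  + by move=> /no'[]; rewrite gs qs => -> ->.
  + exact: sR.
have [O [c st]] := IH (add_edge_sym a b qs) (add_edge_irr ab qi); have [O0 c3 fr sR] := st.
have xa : x != a by apply: contraNneq xS => ->.
have xb : x != b by apply: contraNneq xS => ->.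
have qab : add_edge q a b a b by rewrite /add_edge !eqxx orbT.
have [t [tl tg tlaw]] : exists t, [/\ t \in laws, isSome t = g a b & has_law c t a b].
  have [r1 r2] := sR a b aS bS; case: (boolP (g a b)) => gab; last first.
    by exists None; split=> //; apply: r2.
  have [s [sp _ lw]] := r1 gab; exists (Some s); split=> //; exact: Some_laws.
have [ta [tal tag talaw]] := law_choice xa.
have [tb [tbl tbg tblaw]] := law_choice xb.
rewrite -tag -tbg -tg in ntri.
have [lawa lawb c'3] := kernel_laws c3 xa xb tal tbl tl ntri tlaw.
exists _, (extend c x (kernel ta tb t) a b).
have st' : frac_state S q c.
  split=> // u v uS vS; have [r1 r2] := sR u v uS vS; split=> // quv; apply: r2.
  by rewrite /add_edge quv.
apply: (frac_state_extend xS qs qi xa xb st' c'3 tal lawa) => y yS.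
have [a1 a2] := talaw _ _ lawa; have [b1 b2] := tblaw _ _ lawb.
split=> [gxy|qxy ngxy].
  have /nb [//|E|E] : adj g q x y by rewrite /adj gxy.
    by rewrite E in gxy *; apply: a1.
  by rewrite E in gxy *; apply: b1.
have /nb [//|E|E] : adj g q x y by rewrite /adj qxy orbT.
  by rewrite E in ngxy *; apply: a2.
by rewrite E in ngxy *; apply: b2.
Qed.

End Fractional.

Import Order.TTheory GRing.Theory Num.Theory.

(** * From finite families of transversals to fractional packings *)

Section FracFromFamily.
Variables (R : realType) (T : finType) (g : rel T).
Variables (V : finType) (h : rel V) (L : T -> {set V}).

Lemma frac_packing_of_family (O : finType) (I : O -> {set V}) : 0 < #|O| ->
  (forall o, indep_transversal h L (I o)) ->
  (forall v x, x \in L v -> #|[set o | x \in I o]| * #|L v| = #|O|) ->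
  has_frac_packing R h L.
Proof.
move=> O0 Itr Ix; pose w (J : {set V}) : R := (#|[set o | I o == J]|%:R / #|O|%:R)%R.
have On0 : (#|O|%:R : R)%R != 0%R by rewrite pnatr_eq0 -lt0n.
have cardE' (P : pred O) : #|[set o | P o]| = \sum_(o | P o) 1.
  by rewrite -sum1_card; apply: eq_bigl => o; rewrite inE.
exists w; split=> [J|J|| v x xv].
- by rewrite mulr_ge0 ?invr_ge0 ?ler0n.
- rewrite mulf_eq0 invr_eq0 (negbTE On0) orbF pnatr_eq0 -lt0n => /card_gt0P[o].
  by rewrite inE => /eqP <-.
- rewrite /w -mulr_suml -natr_sum (_ : \sum_J _ = #|O|) ?divff //.
  rewrite -sum1_card [RHS](partition_big I xpredT) //; apply: eq_bigr => J _.
  by rewrite cardE'.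
rewrite /w -mulr_suml -natr_sum (_ : \sum_(J | _) _ = #|[set o | x \in I o]|); last first.
  rewrite cardE' (partition_big I (fun J => x \in J)) //; apply: eq_bigr => J xJ.
  by rewrite cardE'; apply: eq_bigl => o; case: eqVneq => [->|_]; rewrite ?xJ ?andbF.
have Lv0 : (#|L v|%:R : R)%R != 0%R.
  by rewrite pnatr_eq0 -lt0n; apply/card_gt0P; exists x.
by rewrite -(Ix v x xv) natrM invfM mulrA divff ?mul1r // pnatr_eq0; move: (Ix v x xv); lia.
Qed.

(** The uniform distribution on the [k] transversals works: being disjoint, they meet [L v] in [k]
    distinct points and exhaust it. *)
Lemma frac_of_packing k : 0 < k -> (forall v, #|L v| = k) ->
  has_packing h L k -> has_frac_packing R h L.
Proof.
move=> k0 Lk [Is [tr disj]]; apply: (frac_packing_of_family (I := Is)) => //.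
  by rewrite card_ord.
move=> v x xv; rewrite card_ord Lk.
have [e eP] : exists e : 'I_k -> V, forall i, Is i :&: L v = [set e i].
  apply: (fin_all_exists (P := fun i z => Is i :&: L v = [set z])) => i.
  by have [_ /(_ v) /eqP/cards1P] := tr i.
have eIs i : (e i \in Is i) && (e i \in L v).
  by have /setP/(_ (e i)) := eP i; rewrite !inE eqxx.
have uniqI i j y : y \in Is i -> y \in Is j -> i = j.
  move=> yi yj; apply/eqP/negP=> /negP /disj; rewrite -setI_eq0 => /eqP/setP/(_ y).
  by rewrite !inE yi yj.
have einj : injective e.
  move=> i j E; have /andP[ei _] := eIs i; have /andP[ej _] := eIs j.
  by apply: uniqI ei _; rewrite E.
have : x \in e @: setT.
  suff -> : e @: setT = L v by [].
  apply/eqP; rewrite eqEcard Lk card_imset // cardsT card_ord leqnn andbT.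
  by apply/subsetP=> _ /imsetP[i _ ->]; have /andP[] := eIs i.
case/imsetP=> i _ E; rewrite (_ : [set _ | _] = [set i]) ?cards1 ?mul1n //.
have /andP[xi _] := eIs i; rewrite -E in xi.
by apply/setP=> j; rewrite !inE; apply/idP/eqP=> [xj|->//]; apply: uniqI xj xi.
Qed.

End FracFromFamily.

Theorem c_frac3_of_elim (R : realType) (T : finType) (g : rel T) :
  simple_graph g -> elim g setT (@no_edge T) -> P_c_frac g R 3.
Proof.
case=> gs gi el V h L [cov Lk].
case: (pickP V) => [x0 _|noV]; last first.
  by apply: (@frac_of_packing R _ _ _ _ 3) => //; apply: packing_empty => // x; have := noV x.
have [O [c [O0 c3 fr law]]] := @elim_frac_state T g V h L x0 gs gi cov Lk setT (@no_edge T) el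
   (fun _ _ => erefl) (fun _ => erefl).
have cellL v i : i < 3 -> cell L x0 v i \in L v.
  by move=> i3; rewrite -mem_enum mem_nth // -cardE Lk.
have [_ [_ part] _ _ _] := cov.
apply: (frac_packing_of_family _ (I := fun o => [set cell L x0 v (c o v) | v : T])) => // [o|v x xv].
  apply: (transversal_of_choice cov) => [v|u v guv]; first by rewrite cellL.
  have [s [sp cs lw]] := (law u v (in_setT u) (in_setT v)).1 guv.
  (* An edge between the chosen vertices would make this pair of colours have weight zero, yet the
     outcome [o] itself counts in the joint law. *)
  apply/negP=> /(cs _ _ (c3 o u) (c3 o v)) E.
  have := lw _ _ (c3 o u) (c3 o v); rewrite /law_weight E eqxx mul0n => /eqP.
  rewrite muln_eq0 orbF /joint (bigD1 o) //= E !eqxx; lia.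
pose i := index x (enum (L v)).
have i3 : i < 3 by rewrite -(Lk v) cardE index_mem mem_enum.
have xi : x = cell L x0 v i by rewrite /cell nth_index ?mem_enum.
rewrite Lk -(fr v i i3) /freq; congr (_ * _).
rewrite -sum1_card big_mkcond; apply: eq_bigr => o _ /=; rewrite inE.
have -> : (x \in [set cell L x0 v (c o v) | v : T]) = (c o v == i); last by case: (_ == i).
apply/imsetP/eqP=> [[u _ E]|E]; last by exists v; rewrite // E -xi.
have uv : u = v by apply: (part u v x) => //; rewrite E cellL.
subst u; have : nth x0 (enum (L v)) i == nth x0 (enum (L v)) (c o v) by rewrite -!/(cell _ _ _ _) -xi E.
by rewrite nth_uniq ?enum_uniq -?cardE ?Lk // => /eqP.
Qed.

(** * Lower bounds for cycles *)

Section ProductCover.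
Variables (T : finType) (g : rel T) (B : finType) (M : T -> T -> rel B).
Hypotheses (sg : simple_graph g) (Ms : forall u v b c, M u v b c = M v u c b).
Hypothesis Minj : forall u v b c c', M u v b c -> M u v b c' -> c = c'.

Definition prod_rel : rel (T * B) := fun x y =>
  if x.1 == y.1 then x.2 != y.2 else g x.1 y.1 && M x.1 y.1 x.2 y.2.
Definition fibre (v : T) : {set T * B} := [set x | x.1 == v].

Lemma prod_kfold : is_kfold_cover g prod_rel fibre #|B|.
Proof.
have [gs gi] := sg; split; last first.
  move=> v; rewrite -(card_imset _ (_ : injective (fun b : B => (v, b)))) => [|b c []//].
  apply: eq_card => -[u b]; rewrite inE /=; apply/eqP/imsetP=> [->|[c _ []//]].
  by exists b.
split.
- split=> [[u b] [v c]|[u b]]; rewrite /prod_rel /= ?eqxx //.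
  by rewrite eq_sym (eq_sym b) gs Ms.
- split=> [x|u v x]; first by exists x.1; rewrite inE.
  by rewrite !inE => /eqP-> /eqP.
- move=> v [u b] [u' c]; rewrite !inE /prod_rel /= => /eqP-> /eqP->; rewrite eqxx.
  by apply: contra => /eqP->.
- move=> u v [u' b] [v' c] uv ng; rewrite !inE /prod_rel /= => /eqP-> /eqP->.
  by rewrite (negbTE uv) (negbTE ng).
- move=> u v [u' b] [v' c] [v'' c'] guv; rewrite !inE /prod_rel /= => /eqP-> /eqP-> /eqP->.
  have uv : u != v by apply: contraTneq guv => ->; rewrite gi.
  by rewrite (negbTE uv) guv => m m'; rewrite (Minj m m').
Qed.

End ProductCover.

Section LabelCover.
Variables (T : finType) (g : rel T) (B : finType) (lab : T -> B -> nat).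
Hypotheses (sg : simple_graph g) (labI : forall v, injective (lab v)).

Definition label_rel := prod_rel g (fun u v b c => lab u b == lab v c).

Lemma label_kfold : is_kfold_cover g label_rel (@fibre T B) #|B|.
Proof.
apply: (prod_kfold sg) => [u v b c|u v b c c' /eqP E /eqP E'].
  exact: eq_sym.
by apply: (labI (v := v)); rewrite -E.
Qed.

Lemma label_list_cover : is_list_cover g label_rel (@fibre T B).
Proof.
split; first by case: label_kfold.
exists (fun x => lab x.1 x.2); split=> [v [u b] [u' c]|u v [u' b] [v' c] uv].
  by rewrite !inE /= => /eqP-> /eqP-> /labI->.
by rewrite !inE /= => /eqP-> /eqP->; rewrite /label_rel /prod_rel /= (negbTE uv).
Qed.

End LabelCover.

(* The two ends of the edge carry total weight 1 and no transversal contains both. *)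
Lemma frac_packing2_edge (R : realType) (T V : finType) (h : rel V)
    (L : T -> {set V}) (w : {set V} -> R) u v x y (I : {set V}) :
  (forall I, (0 <= w I)%R) -> (forall I, w I != 0%R -> indep_transversal h L I) ->
  (\sum_(I : {set V}) w I = 1)%R ->
  (forall v x, x \in L v -> (\sum_(I : {set V} | x \in I) w I = (#|L v|%:R)^-1)%R) ->
  (forall v, #|L v| = 2) -> x \in L u -> y \in L v -> h x y -> w I != 0%R ->
  (x \in I) = ~~ (y \in I).
Proof.
move=> w0 wtr w1 wx L2 xu yv hxy wI.
have hx := wx u x xu; have hy := wx v y yv; rewrite !L2 in hx hy.
pose f (J : {set V}) : R := (w J - (if x \in J then w J else 0) - (if y \in J then w J else 0))%R.
have f0 J : (0 <= f J)%R.
  rewrite /f; case: (boolP (w J == 0)%R) => [/eqP->|wJ].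
    by rewrite !if_same !subr0.
  have [ind _] := wtr J wJ; case: (boolP (x \in J)) => xJ; case: (boolP (y \in J)) => yJ;
    rewrite ?subr0 ?subrr //.
  by have := ind x y xJ yJ; rewrite hxy.
have sf : (\sum_J f J = 0)%R.
  rewrite /f !sumrB w1 -!big_mkcond hx hy.
  have := splitr (1 : R)%R; rewrite div1r => {1}->.
  by rewrite addrK subrr.
have fI : f I = 0%R.
  by apply/eqP; rewrite (psumr_eq0P (P := xpredT) (F := f)).
have [ind _] := wtr I wI; move: fI; rewrite /f.
case: (boolP (x \in I)) => xI; case: (boolP (y \in I)) => yI //.
  by have := ind x y xI yI; rewrite hxy.
by rewrite !subr0 => E; rewrite E eqxx in wI.
Qed.

Lemma frac_packing_support (R : realType) (V : finType) (w : {set V} -> R) :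
  (\sum_(I : {set V}) w I = 1)%R -> exists I, w I != 0%R.
Proof.
move=> w1; case: (boolP [exists I, w I != 0%R]) => [/existsP//|/existsPn H]; move/eqP: w1.
by rewrite big1 ?(eq_sym 0%R) ?oner_eq0 // => J _; apply/eqP/negPn/H.
Qed.

Lemma not_l_frac1 (R : realType) (T : finType) (g : rel T) u v :
  simple_graph g -> g u v -> ~ P_l_frac g R 1.
Proof.
move=> sg guv H; pose lab (_ : T) (_ : unit) := 0.
have labI w : injective (lab w) by case=> [[]].
have kf := label_kfold sg labI; rewrite card_unit in kf.
have [w [_ wtr w1 _]] := H _ _ _ kf (label_list_cover sg labI).
have [I wI] := frac_packing_support w1; have [ind tr] := wtr I wI.
have inI z : (z, tt) \in I.
  have /eqP/cards1P[[z' []] E] := tr z; have /setP/(_ (z', tt)) := E.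
  by rewrite !inE eqxx => /andP[zI /eqP <-].
have := ind _ _ (inI u) (inI v); rewrite /label_rel /prod_rel /= guv.
by case: eqVneq => // E; move: guv; rewrite E; case: sg => _ ->.
Qed.

(* On an even cycle the lists {1,2}, {2,3}, {3,1}, {1,2}, {1,2}, ... twist the
   two colours once around, so that the parity obstruction is that of an odd cycle. *)
Definition cycle_lab n (v : 'I_n) (b : bool) : nat :=
  if odd n then nat_of_bool b else
  match val v with
  | 0 => if b then 2 else 1
  | 1 => if b then 2 else 3
  | 2 => if b then 1 else 3
  | _ => if b then 1 else 2
  end.

Lemma cycle_lab_inj n (v : 'I_n) : injective (cycle_lab v).
Proof.
by case: v => -[|[|[|v]]] lt [] []; rewrite /cycle_lab; case: (odd n).
Qed.

(** A transversal of nonzero weight contains exactly one end of each cover edge between adjacent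
    lists, so it amounts to one bit per vertex. The bit flips along the [n-1] consecutive edges; the
    closing edge flips it for odd [n] and preserves it for even [n], a contradiction either way. *)
Lemma not_l_frac2_cycle (R : realType) n : 3 < n -> ~ P_l_frac (cycle_rel n) R 2.
Proof.
move=> n3 H; have sg : simple_graph (cycle_rel n) by apply: cycle_simple; lia.
have kf := label_kfold sg (@cycle_lab_inj n); rewrite card_bool in kf.
have [w [w0 wtr w1 wx]] := H _ _ _ kf (label_list_cover sg (@cycle_lab_inj n)).
have [I wI] := frac_packing_support w1; have [_ tr] := wtr I wI.
have L2 : forall v, #|@fibre 'I_n bool v| = 2 by case: kf.
have flip v b : ((v, b) \in I) = b (+) ((v, false) \in I).
  case: b; rewrite ?addFb //.
  have := tr v; rewrite (cardsD1 (v, true)) (cardsD1 (v, false)) !inE eqxx.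
  rewrite (_ : _ :\ _ :\ _ = set0) ?cards0; last first.
    apply/setP=> -[u b]; rewrite !inE !xpair_eqE; case: (eqVneq u v) => [->|]; rewrite ?andbF //.
    by case: b.
  by rewrite !xpair_eqE !eqxx /= ?andbT; case: ((v, true) \in I); case: ((v, false) \in I).
have edge (u v : 'I_n) b c : cycle_rel n u v -> u != v -> cycle_lab u b = cycle_lab v c ->
    ((u, b) \in I) = ~~ ((v, c) \in I).
  move=> guv uv E; apply: (frac_packing2_edge w0 wtr w1 wx L2 (u := u) (v := v)) => //;
    rewrite ?inE //.
  by rewrite /label_rel /prod_rel /= (negbTE uv) guv E eqxx.
have n0 : 0 < n by lia.
pose s i := if insub i is Some v then (v, false) \in I else false.
have sE i (lt : i < n) : s i = ((Ordinal lt, false) \in I) by rewrite /s insubT.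
have step i : i.+1 < n -> s i.+1 = ~~ s i.
  move=> lt; have lt' : i < n by lia.
  rewrite (sE _ lt) (sE _ lt').
  (* Consecutive lists share a colour carried by the same boolean. *)
  have [b E] : exists b, cycle_lab (Ordinal lt') b = cycle_lab (Ordinal lt) b.
    rewrite /cycle_lab /=; case: (odd n); first by exists true.
    by case: i lt lt' => [|[|[|i]]] lt lt'; [exists true | exists false | exists true | exists true].
  have := edge _ _ b b _ _ E; rewrite !(flip _ b) cycle_relE /= ?eqxx; last by lia.
  rewrite -val_eqE /= => /(_ isT); rewrite neq_ltn ltnSn => /(_ isT).
  by case: b {E}; case: (_ \in I); case: (_ \in I).
have all_s i : i < n -> s i = s 0 (+) odd i.
  elim: i => [|i IH] lt; first by rewrite addbF.
  by rewrite step // IH /=; [case: (s 0); case: (odd i) | lia].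
have lt : n.-1 < n by lia.
have := all_s n.-1 lt; rewrite (sE _ lt) (sE _ n0).
(* The closing edge matches [true] with [odd n]: no twist for odd [n], a swap for even [n]. *)
have [b E] : exists b, cycle_lab (Ordinal lt) true = cycle_lab (Ordinal n0) b /\ b = odd n.
  rewrite /cycle_lab /=; case: (odd n); first by exists true.
  by exists false; case: n n3 {H kf w w0 wtr w1 wx I wI tr L2 flip edge n0 s sE step all_s
    lt sg} => [|[|[|[|m]]]].
case: E => E bn; have := edge _ _ true b _ _ E; rewrite flip (flip _ b) cycle_relE /=; last by lia.
rewrite !eqxx !orbT -val_eqE /= => /(_ isT) => h.
have -> : odd n.-1 = ~~ odd n by rewrite -[in odd n](prednK n0) /= negbK.
move: h; rewrite bn neq_ltn; have -> : (0 < n.-1) by lia.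
rewrite orbT => /(_ isT).
by case: (odd n); case: (_ \in I); case: (_ \in I).
Qed.

(** * Parity obstruction to 3-fold correspondence packings of cycles *)

Definition shifts (a : seq nat) := [seq [seq (x + d) %% 3 | x <- a] | d <- iota 0 3].

(** [shifts a] consists of the permutations that differ from [a] by a translation of Z/3, that is,
    by an even permutation. Permutations agreeing nowhere differ by a nonzero translation. *)
Lemma shifts_avoids : all (fun a => all (fun b => all (fun c =>
  avoids b c ==> (c \in shifts a)) perms3) (shifts a)) perms3.
Proof. by vm_compute. Qed.

(** Negation is a transposition of Z/3, so [-b] differs from [a] by an odd permutation, which has a
    fixed point. *)
Lemma shifts_twist : all (fun a => all (fun b =>
  ~~ avoids a [seq (3 - x) %% 3 | x <- b]) (shifts a)) perms3.
Proof. by vm_compute. Qed.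

Lemma shifts_refl : all (fun a => a \in shifts a) perms3.
Proof. by vm_compute. Qed.

(* The closing edge of the cycle carries the odd permutation [b |-> -b] of Z/3,
   whereas two disjoint permutations of Z/3 differ by an even one. *)
Definition twist_rel n (u v : 'I_n) : rel 'I_3 := fun b c =>
  if (u == 0 :> nat) && (v == n.-1 :> nat) || (v == 0 :> nat) && (u == n.-1 :> nat)
  then (b + c) %% 3 == 0 else b == c.

Lemma not_c_star3_cycle n : 3 < n -> ~ P_c_star (cycle_rel n) 3.
Proof.
move=> n3 H; have sg : simple_graph (cycle_rel n) by apply: cycle_simple; lia.
have kf : is_kfold_cover (cycle_rel n) (prod_rel (cycle_rel n) (@twist_rel n)) (@fibre _ _) #|'I_3|.
  apply: (prod_kfold sg) => [u v b c|u v b c c'].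
    by rewrite /twist_rel orbC (addnC b) (eq_sym b).
  rewrite /twist_rel; case: ifP => _; last by move=> /eqP <- /eqP.
  have := ltn_ord b; have := ltn_ord c; have := ltn_ord c' => c'3 c3 b3 /eqP e /eqP e'.
  by apply: ord_inj; lia.
rewrite card_ord in kf; have [Is [tr disj]] := H _ _ _ kf.
have ex (p : 'I_n * 'I_3) : exists b, (p.1, b) \in Is p.2.
  have [_ /(_ p.1) /eqP/cards1P[[u b] E]] := tr p.2; have /setP/(_ (u, b)) := E.
  by rewrite !inE eqxx => /andP[h /eqP E']; exists b; rewrite -E'.
have [f' f'P] := fin_all_exists ex.
pose f v k := f' (v, k).
have fP v k : (v, f v k) \in Is k by apply: (f'P (v, k)).
have finj v : injective (f v).
  move=> k l E; apply/eqP/negP=> /negP /disj; rewrite -setI_eq0 => /eqP/setP/(_ (v, f v k)).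
  by rewrite !inE fP E fP.
have n0 : 0 < n by lia.
pose vt i := insubd (Ordinal n0) i.
have vtE i : i < n -> val (vt i) = i by move=> lt; rewrite val_insubd lt.
(* [F i] records the colours that the three transversals use at vertex [i], always in the same order
   of the transversals. *)
pose F i := [seq val (f (vt i) k) | k <- enum 'I_3].
have Fsize i : size (F i) = 3 by rewrite size_map size_enum_ord.
have Fperm i : F i \in perms3.
  rewrite mem_permutations; have uF : uniq (F i).
    by rewrite map_inj_uniq ?enum_uniq // => k l /val_inj/finj.
  apply: uniq_perm; rewrite ?iota_uniq //.
  have sub : {subset F i <= iota 0 3} by move=> x /mapP[k _ ->]; rewrite mem_iota0 ltn_ord.
  by apply: (uniq_min_size uF sub _).2; rewrite Fsize size_iota.
have sep (u v : 'I_n) k : cycle_rel n u v -> u != v -> ~~ twist_rel u v (f u k) (f v k).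
  move=> guv uv; have [ind _] := tr k; have := ind _ _ (fP u k) (fP v k).
  by rewrite /prod_rel /= (negbTE uv) guv.
have avoidsI (G1 G2 : 'I_3 -> nat) : (forall k, G1 k != G2 k) ->
    avoids [seq G1 k | k <- enum 'I_3] [seq G2 k | k <- enum 'I_3].
  by move=> ne; rewrite /avoids; elim: (enum 'I_3) => //= k e ->; rewrite ne.
have step i : i.+1 < n -> avoids (F i) (F i.+1).
  move=> lt; apply: avoidsI => k; have lt' : i < n by lia.
  have := sep (vt i) (vt i.+1) k; rewrite cycle_relE ?vtE ?eqxx; try lia.
  rewrite -val_eqE /= !vtE // => /(_ isT); rewrite neq_ltn ltnSn => /(_ isT).
  rewrite /twist_rel !vtE // ifF; first by [].
  by apply/negP; lia.
have all_F i : i < n -> F i \in shifts (F 0).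
  elim: i => [|i IH] lt; first exact: (allP shifts_refl).
  have := allP (allP (allP shifts_avoids _ (Fperm 0)) _ (IH _)) _ (Fperm i.+1).
  by rewrite step // implyTb; apply; lia.
have lt : n.-1 < n by lia.
have /negP[] := allP (allP shifts_twist _ (Fperm 0)) _ (all_F _ lt).
rewrite -map_comp; apply: avoidsI => k /=.
have := sep (vt 0) (vt n.-1) k; rewrite cycle_relE ?vtE ?eqxx //; try lia.
rewrite -val_eqE /= !vtE // ?orbT => /(_ isT).
have -> : 0 != n.-1 by lia.
move=> /(_ isT); rewrite /twist_rel !vtE // !eqxx /=.
by have := ltn_ord (f (vt 0) k); have := ltn_ord (f (vt n.-1) k); lia.
Qed.

Lemma P_l_frac_of_c_frac (R : realType) (T : finType) (g : rel T) k :
  P_c_frac g R k -> P_l_frac g R k.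
Proof. by move=> H V h L kf _; apply: H. Qed.

Lemma P_l_frac_of_l_star (R : realType) (T : finType) (g : rel T) k : 0 < k ->
  P_l_star g k -> P_l_frac g R k.
Proof.
move=> k0 H V h L kf lc; have [_ Lk] := kf.
by apply: (frac_of_packing R k0 Lk); apply: H.
Qed.

Lemma P_l_star_of_c_star (T : finType) (g : rel T) k : P_c_star g k -> P_l_star g k.
Proof. by move=> H V h L kf _; apply: H. Qed.

Lemma upper_bounds (R : realType) (T : finType) (g : rel T) :
  simple_graph g -> elim g setT (@no_edge T) ->
  [/\ chi_le (P_c_star g) 4, chi_le (P_l_frac g R) 3,
      chi_le (P_l_star g) 3 & chi_le (P_c_frac g R) 3].
Proof.
move=> sg el; have cf := c_frac3_of_elim R sg el; split; first exists 4; try exists 3; split=> //.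
- exact: c_packing4_of_elim.
- exact: P_l_frac_of_c_frac.
- exact: l_packing3_of_elim.
Qed.

Theorem mainTheorem19 (R : realType) :
  (forall (T : finType) (g : rel T),
      simple_graph g -> ~ has_K4_minor g -> triangle_free g ->
      [/\ chi_le (P_c_star g) 4, chi_le (P_l_frac g R) 3,
          chi_le (P_l_star g) 3 & chi_le (P_c_frac g R) 3]) /\
  (forall n : nat, (4 <= n)%N ->
      [/\ chi_eq (P_c_star (cycle_rel n)) 4, chi_eq (P_l_frac (cycle_rel n) R) 3,
          chi_eq (P_l_star (cycle_rel n)) 3 & chi_eq (P_c_frac (cycle_rel n) R) 3]).
Proof.
split=> [T g sg nK tf|n n4]; first by apply: upper_bounds => //; apply: elim_K4_minor_free.
have sg : simple_graph (cycle_rel n) by apply: cycle_simple; lia.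
have [u1 u2 u3 u4] := upper_bounds R sg (elim_cycle n4).
(* For positive [k] fractional list packing is the weakest of the four properties, so this excludes
   [k] at most 2 for all of them; only [k = 3] for [P_c_star] remains. *)
have nlf : ~ chi_le (P_l_frac (cycle_rel n) R) 2.
  case=> -[|[|[|k]]] [] // _; last exact: not_l_frac2_cycle.
  have lt0 : 0 < n by lia.
  have lt1 : 1 < n by lia.
  by apply: (@not_l_frac1 R _ _ (Ordinal lt0) (Ordinal lt1)) => //; rewrite cycle_relE //; lia.
split; split=> //.
- case=> k [/andP[k0]]; rewrite leq_eqVlt => /orP[/eqP->|k2] Pk.
    exact: not_c_star3_cycle Pk.
  apply: nlf; exists k; rewrite k0; split=> //.
  by apply: P_l_frac_of_l_star => //; apply: P_l_star_of_c_star.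
- case=> k [/[dup] kk /andP[k0 _]] Pk; apply: nlf; exists k; split=> //.
  exact: P_l_frac_of_l_star.
- case=> k [kk Pk]; apply: nlf; exists k; split=> //.
  exact: P_l_frac_of_c_frac.
Qed.
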